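(* Let $f$ be a rational function of degree $d\ge 1$, viewed as a map of the Riemann sphere $\overline{\mathbb{C}}$ to itself, and let $C$ be any circle on the Riemann sphere. Then the spherical length of the preimage $f^{-1}(C)$ is at most $d$ times the length of a great circle.
   Context: Circles on the Riemann sphere $\overline{\mathbb{C}}=\mathbb{C}\cup\{\infty\}$ are the Euclidean circles in $\mathbb{C}$ together with the lines in $\mathbb{C}$ completed by $\infty$. Spherical length is length with respect to the spherical metric on $\overline{\mathbb{C}}$, identified with a round sphere by stereographic projection (for example the metric $2|dz|/(1+|z|^2)$ of the unit sphere, for which great circles have length $2\pi$). The degree of a rational function is its topological degree as a self-map of $\overline{\mathbb{C}}$, that is, the maximum of the degrees of numerator and denominator in lowest terms. *)

(* Defs.v *)
From HB Require Import structures.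
From mathcomp Require Import all_boot all_order all_algebra.
From mathcomp Require Import all_classical all_reals all_analysis.
From mathcomp Require Export complex.

Set Implicit Arguments.
Unset Strict Implicit.
Unset Printing Implicit Defensive.

Import Order.TTheory GRing.Theory Num.Theory.
Local Open Scope classical_set_scope.
Local Open Scope complex_scope.
Local Open Scope ring_scope.

(* One-dimensional Hausdorff measure for a distance function [dist]. With
   weight [diam] (no normalizing constant) it agrees with the arc length of
   rectifiable simple curves. *)
Section Hausdorff1.
Context {R : realType} {T : Type} (dist : T -> T -> R).

(* The extra [0] makes the diameter of the empty set equal to 0, not -oo. *)
Definition diam (A : set T) : \bar R :=
  ereal_sup ([set 0%E] `|` [set (dist x.1 x.2)%:E | x in A `*` A]).

Definition hausdorff1_delta (delta : R) (A : set T) : \bar R :=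
  ereal_inf [set (\sum_(0 <= k <oo) diam (B k))%E | B in
    [set B : nat -> set T |
      A `<=` \bigcup_k B k /\ forall k, (diam (B k) <= delta%:E)%E]].

Definition hausdorff1 (A : set T) : \bar R :=
  ereal_sup [set hausdorff1_delta delta A | delta in [set delta : R | 0 < delta]].

End Hausdorff1.

Section RiemannSphere.
Context {R : realType}.

(* [None] is the point at infinity. *)
Definition sphere : Type := option R[i].

(* Inverse stereographic projection onto the unit sphere of R^3, sending
   infinity to the north pole (0, 0, 1). *)
Definition stereo (z : sphere) : 'rV[R]_3 :=
  match z with
  | Some (x +i* y) =>
      let m := x ^+ 2 + y ^+ 2 in
      \row_(k < 3) [:: 2 * x / (m + 1); 2 * y / (m + 1); (m - 1) / (m + 1)]`_k
  | None => \row_(k < 3) [:: 0; 0; 1]`_k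
  end.

(* The geodesic distance of the round unit sphere, i.e. the distance of the
   Riemannian metric 2|dz|/(1+|z|^2). *)
Definition spherical_dist (z w : sphere) : R :=
  acos (\sum_(k < 3) stereo z ord0 k * stereo w ord0 k).

Definition spherical_length : set sphere -> \bar R := hausdorff1 spherical_dist.

Definition is_circle (C : set sphere) : Prop :=
  (exists (c : R[i]) (r : R), 0 < r /\
     C = [set Some z | z in [set z : R[i] | `|z - c| = r%:C]])
  \/
  (exists a v : R[i], v != 0 /\
     C = None |` [set Some (a + t%:C * v) | t in [set: R]]).

Definition ratdeg (p q : {poly R[i]}) : nat := (maxn (size p) (size q)).-1.

(* The self-map of the sphere given by p / q, for coprime p and q. Its value at
   infinity is the ratio of the coefficients of degree [ratdeg p q], which are
   not both 0. *)
Definition ratmap (p q : {poly R[i]}) (z : sphere) : sphere :=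
  let: (a, b) := if z is Some w then (p.[w], q.[w])
                 else (p`_(ratdeg p q), q`_(ratdeg p q)) in
  if b == 0 then None else Some (a / b).

Definition is_rational (d : nat) (f : sphere -> sphere) : Prop :=
  exists p q : {poly R[i]},
    [/\ coprimep p q, q != 0, d = ratdeg p q & f = ratmap p q].

End RiemannSphere.

Arguments sphere R : clear implicits.

(* Main.v *)
Require Import Defs.
From HB Require Import structures.
From mathcomp Require Import all_boot all_order all_algebra.
From mathcomp Require Import all_classical all_reals all_analysis.
From mathcomp Require Import separable measurable_realfun ring lra zify.

Set Implicit Arguments.
Unset Strict Implicit.
Unset Printing Implicit Defensive.

Import Order.TTheory GRing.Theory Num.Theory.
Import numFieldNormedType.Exports.
Local Open Scope classical_set_scope.
Local Open Scope ring_scope.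

(** Crofton's formula expresses the length of a spherical curve as pi times the
mean number of its intersections with a great circle, so it is enough that
almost every great circle meets the preimage in at most [2 d] points.

After a Moebius change of the target the circle [C] is the extended real line,
and the preimage, up to the point at infinity, lies in the set E of those [z]
for which [p.[z]] times the conjugate of [q.[z]] is real ([real_ratio]). If a
great circle is not contained in E, parametrize it by the projective real line
so that its point at infinity falls outside E: the points of E on it are then
real roots of a polynomial of degree exactly [2 d] ([great_circle_count]).
Few great circles are contained in E: fix one that is not; every great circle
meets it, and one contained in E does so in one of its at most [2 d] points of E.
The normals of such great circles lie therefore in finitely many planes
([generic_great_circle]).

Crofton's formula enters as an inequality for finitely many chords
([crofton_bound]). Great circles are represented by their normal vectors,
distributed uniformly in the unit ball of R^3. An arc meets every great circle
that separates its end points, and the volume of the normals that separate two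
unit vectors at angle [alpha] is at least [alpha / (pi + alpha)] times the
volume of the ball ([sep_volume_lune]): about [pi / alpha] rotated copies of
this double lune cover the ball. The rotation invariance of Lebesgue measure
comes from the translation invariance on the line, since a rotation of the
plane is a product of three shears.

To pass from chords to Hausdorff measure, E is parametrized by the value
[w = p / q], which is real on E. Off finitely many points, the fibre over [w]
consists of [d] simple roots, which move with [w]; near a given [w] the
spherical distance of the positions of a root at times [s] and [t] is
proportional to [`|s - t|] up to a factor close to 1 ([local_stretch],
[good_value_interval]). Over a short interval of values the arc swept by a root
is thus hardly larger in diameter than its chord. The maximal dyadic intervals
of values that are short in this sense ([maximal_dyadic_cover]) cut E, up to
finitely many points, into countably many disjoint arcs. The sum of their chords
is bounded by Crofton's inequality, hence so is the sum of their diameters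
([real_preimage_delta]). *)

(** * Rotation invariance of Lebesgue measure in space *)

Section LebesgueR3.
Context {R : realType}.
Local Notation L := (@lebesgue_measure R).
Local Notation T1 := (measurableTypeR R).

Lemma lebesgue_shift (t : R) (A : set T1) : measurable A ->
  L ((fun x : T1 => (x + t : T1)) @^-1` A) = L A.
Proof.
have ms : measurable_fun setT (fun x : T1 => (x + t : T1)).
  by apply: measurable_funD => //; exact: measurable_cst.
pose phi : {mfun T1 >-> T1} := HB.pack (fun x : T1 => (x + t : T1))
  (isMeasurableFun.Build _ _ _ _ _ ms).
move=> mA; apply/esym; apply: (@lebesgue_measure_unique R (pushforward L phi)) => //.
move=> X [[a b] _ <-] /=; rewrite /pushforward.
have -> : phi @^-1` `]a, b]%classic = `]a - t, b - t]%classic.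
  by apply/seteqP; split => x; rewrite /phi /= !in_itv /= ltrBlDr lerBrDr.
rewrite !lebesgue_measure_itv /= !lte_fin ltrD2r; case: ifP => // _.
by rewrite -!EFinB; congr (_%:E); ring.
Qed.

Local Notation T2 := (T1 * T1)%type.

Lemma lebesgue2_sigma_finite : sigma_finite setT (L \x L)%E.
Proof.
have /sigma_finiteP[F [TF ndF Foo]] := sigma_finiteT L.
exists (fun n => F n `*` F n).
  rewrite -setXTT TF predeqE => -[x y]; split.
    move=> [/= [n _ Fnx] [k _ Fky]]; exists (maxn n k) => //; split => /=.
    - by move: x Fnx; exact/subsetPset/ndF/leq_maxl.
    - by move: y Fky; exact/subsetPset/ndF/leq_maxr.
  by move=> [n _ []/= ? ?]; split; exists n.
move=> k; have [? ?] := Foo k.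
split; first exact: measurableX.
by rewrite product_measure1E// lte_mul_pinfty// ge0_fin_numE.
Qed.

(** A constant of its own, so that the product with a third line sees the
sigma-finiteness of the measure of the plane. *)
Definition lebesgue2 : set T2 -> \bar R := (L \x L)%E.
HB.instance Definition _ := Measure.on lebesgue2.
HB.instance Definition _ :=
  Measure_isSigmaFinite.Build _ _ _ lebesgue2 lebesgue2_sigma_finite.
Local Notation L2 := lebesgue2.

Lemma lebesgue2E (A : set T2) : measurable A -> L2 A = (\int[L]_y L (ysection A y))%E.
Proof.
move=> mA; rewrite /lebesgue2 [LHS](_ : _ = (\int[L \x L]_z (\1_A z)%:E)%E).
  rewrite indic_fubini_tonelli1 // indic_fubini_tonelli //.
  by apply: eq_integral => y _; rewrite indic_fubini_tonelli_GE.
by rewrite integral_indic // setIT.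
Qed.

Definition shear1 (t : R) (p : T2) : T2 := (p.1 + t * p.2, p.2).
Definition shear2 (t : R) (p : T2) : T2 := (p.1, p.2 + t * p.1).

Lemma measurable_shear1 (t : R) : measurable_fun setT (shear1 t).
Proof.
apply/measurable_fun_pair => //; apply: measurable_funD => //.
exact: measurable_funM.
Qed.

Lemma measurable_shear2 (t : R) : measurable_fun setT (shear2 t).
Proof.
apply/measurable_fun_pair => //; apply: measurable_funD => //.
exact: measurable_funM.
Qed.

Lemma lebesgue2_shear1 (t : R) (A : set T2) : measurable A ->
  L2 ((shear1 t) @^-1` A) = L2 A.
Proof.
move=> mA; have mA' := measurable_shear1 t measurableT mA; rewrite setTI in mA'.
rewrite (lebesgue2E mA) (lebesgue2E mA'); apply: eq_integral => y _.
rewrite -(lebesgue_shift (t * y) (measurable_ysection y mA)); congr (L _).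
Qed.

Lemma lebesgue2_shear2 (t : R) (A : set T2) : measurable A ->
  L2 ((shear2 t) @^-1` A) = L2 A.
Proof.
move=> mA; have mA' := measurable_shear2 t measurableT mA; rewrite setTI in mA'.
rewrite /lebesgue2 /product_measure1; apply: eq_integral => y _ /=.
rewrite -(lebesgue_shift (t * y) (measurable_xsection y mA)); congr (L _).
Qed.

Definition rot2 (c s : R) (p : T2) : T2 := (c * p.1 - s * p.2, s * p.1 + c * p.2).

Lemma measurable_rot2 c s : measurable_fun setT (rot2 c s).
Proof.
by apply/measurable_fun_pair; [apply: measurable_funB|apply: measurable_funD];
  apply: measurable_funM.
Qed.

(** Off the half turn and the identity, a rotation is a product of three shears;
the half turn is the square of a quarter turn. *)
Lemma lebesgue2_rot (c s : R) (A : set T2) : c ^+ 2 + s ^+ 2 = 1 ->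
  measurable A -> L2 (rot2 c s @^-1` A) = L2 A.
Proof.
have rotS c' s' B : c' ^+ 2 + s' ^+ 2 = 1 -> s' != 0 -> measurable B ->
    L2 (rot2 c' s' @^-1` B) = L2 B.
  move=> cs s0 mB; pose t := (c' - 1) / s'.
  have m1 := measurable_shear1 t measurableT mB; rewrite setTI in m1.
  have m2 := measurable_shear2 s' measurableT m1; rewrite setTI in m2.
  have -> : rot2 c' s' = shear1 t \o shear2 s' \o shear1 t.
    apply/funext => -[x y]; rewrite /rot2 /shear1 /shear2 /t /=.
    have -> : c' * x - s' * y = c' * x + (c' ^+ 2 - 1) / s' * y.
      by rewrite -cs; field.
    by congr pair; field.
  by rewrite !comp_preimage (lebesgue2_shear1 t m2) (lebesgue2_shear2 s' m1) lebesgue2_shear1.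
move=> cs mA; have [s0|] := eqVneq s 0; last by move=> ?; exact: rotS.
have : (c - 1) * (c + 1) = 0 by rewrite s0 in cs; lra.
move/eqP; rewrite mulf_eq0 => /orP[] /eqP c1.
  rewrite (_ : rot2 c s = id) //; apply/funext => -[x y].
  by rewrite /rot2 s0 (_ : c = 1) /=; [congr pair; ring|lra].
have m1 := measurable_rot2 0 1 measurableT mA; rewrite setTI in m1.
have c01 : (0 : R) ^+ 2 + 1 ^+ 2 = 1 by ring.
have -> : rot2 c s = rot2 0 1 \o rot2 0 1.
  apply/funext => -[x y]; rewrite /rot2 s0 (_ : c = -1) /=; last lra.
  by congr pair; ring.
by rewrite comp_preimage (rotS _ _ _ c01) ?oner_neq0 // (rotS _ _ _ c01) ?oner_neq0.
Qed.

Local Notation T3 := (T1 * T2)%type.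

Definition lebesgue3 : set T3 -> \bar R := (L \x L2)%E.
HB.instance Definition _ := Measure.on lebesgue3.
Local Notation L3 := lebesgue3.

Definition rot23 (c s : R) (p : T3) : T3 := (p.1, rot2 c s p.2).

Definition rot12 (c s : R) (p : T3) : T3 :=
  let q := rot2 c s (p.1, p.2.1) in (q.1, (q.2, p.2.2)).

Lemma lebesgue3_rot23 (c s : R) (A : set T3) : c ^+ 2 + s ^+ 2 = 1 ->
  measurable A -> L3 (rot23 c s @^-1` A) = L3 A.
Proof.
move=> cs mA; apply: eq_integral => x _.
exact: (lebesgue2_rot cs (measurable_xsection x mA)).
Qed.

(** Tonelli's theorem regroups the coordinates, so that rotations of the first two
become as accessible as rotations of the last two. *)
Lemma lebesgue3E (A : set T3) : measurable A ->
  L3 A = (\int[L]_z L2 [set p : T2 | A (p.1, (p.2, z))])%E.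
Proof.
move=> mA.
pose A' : set (T2 * T1) := (fun q => (q.1.1, (q.2, q.1.2))) @^-1` A.
have mA' : measurable A'.
  have m : measurable_fun setT (fun q : T2 * T1 => (q.1.1, (q.2, q.1.2)) : T3).
    apply/measurable_fun_pair; first exact: measurableT_comp.
    by apply/measurable_fun_pair => //; exact: measurableT_comp.
  by have := m measurableT _ mA; rewrite setTI.
pose f (p : T2) := L (xsection A' p).
have mf : measurable_fun setT f by exact: measurable_fun_xsection.
have f0 p : (0 <= f p)%E by [].
transitivity (\int[L]_x \int[L]_z f (x, z))%E.
  rewrite [LHS]/lebesgue3 [LHS]/product_measure1; apply: eq_integral => x _ /=.
  rewrite [LHS]lebesgue2E; last exact: measurable_xsection.
  apply: eq_integral => z _; congr (L _).
  by apply/seteqP; split => y /=; rewrite /xsection /ysection /= !inE /= !inE.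
rewrite fubini_tonelli //; apply: eq_integral => z _.
Qed.

Lemma measurable_rot12 c s : measurable_fun setT (rot12 c s).
Proof.
have m21 : measurable_fun setT (fun p : T3 => p.2.1) by exact: measurableT_comp.
apply/measurable_fun_pair => /=; first by apply: measurable_funB; apply: measurable_funM.
apply/measurable_fun_pair => /=; last exact: measurableT_comp.
by apply: measurable_funD; apply: measurable_funM.
Qed.

Lemma lebesgue3_rot12 (c s : R) (A : set T3) : c ^+ 2 + s ^+ 2 = 1 ->
  measurable A -> L3 (rot12 c s @^-1` A) = L3 A.
Proof.
move=> cs mA; have m1 := measurable_rot12 c s measurableT mA; rewrite setTI in m1.
rewrite (lebesgue3E mA) (lebesgue3E m1); apply: eq_integral => z _.
apply: (lebesgue2_rot (A := [set p : T2 | A (p.1, (p.2, z))]) cs).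
have m : measurable_fun setT (fun q : T2 => (q.1, (q.2, z)) : T3).
  by apply/measurable_fun_pair => //; exact/measurable_fun_pair.
by have := m measurableT _ mA; rewrite setTI.
Qed.

End LebesgueR3.

(** * Great circles separating two points *)

Lemma measure_cover_seq d (T : measurableType d) (R : realType)
    (mu : {measure set T -> \bar R}) (I : choiceType) (s : seq I) (F : I -> set T)
    (A : set T) : (forall i, measurable (F i)) -> measurable A ->
  (forall x, A x -> exists2 i, i \in s & F i x) ->
  (mu A <= \sum_(i <- s) mu (F i))%E.
Proof.
move=> mF mA As; apply: (@le_trans _ _ (mu (\big[setU/set0]_(i <- s) F i))).
  apply: le_measure; rewrite ?inE //; first exact: bigsetU_measurable.
  move=> x /As[i si Fx]; rewrite -bigcup_seq; exists i => //.
elim: s {As} => [|i s IHs]; first by rewrite !big_nil measure0.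
rewrite !big_cons; apply: le_trans (measureU2 _ _ _) _ => //.
  exact: bigsetU_measurable.
exact: leeD2l.
Qed.

Section Crofton.
Context {R : realType}.
Local Notation L := (@lebesgue_measure R).
Local Notation T1 := (measurableTypeR R).
Local Notation vec := (T1 * (T1 * T1))%type.
Local Notation vol := (@lebesgue3 R).
Implicit Types a b n : vec.

Definition dot3 n a : R := n.1 * a.1 + (n.2.1 * a.2.1 + n.2.2 * a.2.2).

Definition plane a : set vec := [set n | dot3 n a = 0].

(** The great circle with normal [n] separates [a] and [b]. *)
Definition sep a b : set vec := [set n | dot3 n a * dot3 n b < 0].

Definition ball3 : set vec := [set n | dot3 n n <= 1].

Lemma measurable_dot3 a : measurable_fun setT (fun n => dot3 n a).
Proof.
apply: measurable_funD; first exact: measurable_funM.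
by apply: measurable_funD; apply: measurable_funM => //; exact: measurableT_comp.
Qed.

Lemma measurable_plane a : measurable (plane a).
Proof.
by rewrite -[plane a]setTI; exact: measurable_dot3 measurableT _ (measurable_set1 0).
Qed.

Lemma measurable_sep a b : measurable (sep a b).
Proof.
have mf : measurable_fun setT (fun n => dot3 n a * dot3 n b).
  by apply: measurable_funM; exact: measurable_dot3.
have -> : sep a b = setT `&` (fun n => dot3 n a * dot3 n b) @^-1` `]-oo, 0[%classic.
  by rewrite setTI; apply/seteqP; split => n; rewrite /sep /= in_itv.
exact: mf.
Qed.

Lemma measurable_ball3 : measurable ball3.
Proof.
have m21 : measurable_fun setT (fun n : vec => n.2.1) by exact: measurableT_comp.
have m22 : measurable_fun setT (fun n : vec => n.2.2) by exact: measurableT_comp.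
have mf : measurable_fun setT (fun n => dot3 n n).
  by do 2! [apply: measurable_funD; first exact: measurable_funM]; exact: measurable_funM.
have -> : ball3 = setT `&` (fun n => dot3 n n) @^-1` `]-oo, 1]%classic.
  by rewrite setTI; apply/seteqP; split => n; rewrite /ball3 /= in_itv.
exact: mf.
Qed.

Lemma vol_box (A B C : set T1) : measurable A -> measurable B -> measurable C ->
  vol (A `*` (B `*` C)) = (L A * (L B * L C))%E.
Proof.
move=> mA mB mC; rewrite -(product_measure1E L L mB mC).
by rewrite -(product_measure1E L lebesgue2 mA (measurableX mB mC)).
Qed.

Lemma vol_ball3_fin : vol ball3 \is a fin_num.
Proof.
pose I := `[(-1 : R), 1]%classic : set T1.
have mI : measurable I by exact: measurable_itv.
have vI : (vol (I `*` (I `*` I)) = 8%:E)%E.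
  rewrite vol_box; [|exact: measurable_itv..]; rewrite /I lebesgue_measure_itv /= lte_fin.
  have -> : -1 < 1 :> R by lra.
  by rewrite -!EFinD -!EFinM; congr (_%:E); ring.
rewrite ge0_fin_numE // (le_lt_trans _ (ltry 8)) // -vI.
apply: le_measure; rewrite ?inE.
- exact: measurable_ball3.
- exact: measurableX mI (measurableX mI mI).
- by move=> [x [y z]]; rewrite /ball3 /I /dot3 /= !in_itv /= => h; split; [|split];
  apply/andP; split; nra.
Qed.

Lemma vol_ball3_gt0 : (0 < vol ball3)%E.
Proof.
pose I := `[(0 : R), 2^-1]%classic : set T1.
have mI : measurable I by exact: measurable_itv.
have vI : (vol (I `*` (I `*` I)) = (8^-1)%:E)%E.
  rewrite vol_box; [|exact: measurable_itv..]; rewrite /I lebesgue_measure_itv /= lte_fin invr_gt0 ltr0n.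
  by rewrite -!EFinD -!EFinM; congr (_%:E); field.
apply: (@lt_le_trans _ _ (8^-1)%:E); first by rewrite lte_fin.
rewrite -vI; apply: le_measure; rewrite ?inE.
- exact: measurableX mI (measurableX mI mI).
- exact: measurable_ball3.
- move=> [x [y z]]; rewrite /ball3 /I /dot3 /= !in_itv /=.
  by move=> [/andP[? ?] [/andP[? ?] /andP[? ?]]]; nra.
Qed.

(** Rotations of the first two and of the last two coordinates generate the
rotation group; this predicate is what is used of its elements. *)
Definition vol_isometry (g : vec -> vec) :=
  [/\ measurable_fun setT g, forall A, measurable A -> vol (g @^-1` A) = vol A
  & forall n a, dot3 (g n) (g a) = dot3 n a].

Lemma vol_isometry_comp g h : vol_isometry g -> vol_isometry h -> vol_isometry (g \o h).
Proof.
move=> [mg vg dg] [mh vh dh]; split; first exact: measurableT_comp.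
  move=> A mA; rewrite comp_preimage vh ?vg // -[X in measurable X]setTI.
  exact: mg.
by move=> n a; rewrite /= dg dh.
Qed.

Lemma rot23_isometry c s : c ^+ 2 + s ^+ 2 = 1 -> vol_isometry (@rot23 R c s).
Proof.
move=> cs; split; first 2 last.
- move=> [n1 [n2 n3]] [a1 [a2 a3]]; rewrite /dot3 /rot23 /rot2 /=; congr (_ + _).
  by rewrite -[RHS]mul1r -cs; ring.
- apply/measurable_fun_pair => //; apply: measurableT_comp => //.
  exact: measurable_rot2.
- by move=> A; exact: lebesgue3_rot23.
Qed.

Lemma rot12_isometry c s : c ^+ 2 + s ^+ 2 = 1 -> vol_isometry (@rot12 R c s).
Proof.
move=> cs; split; first 2 last.
- move=> [n1 [n2 n3]] [a1 [a2 a3]]; rewrite /dot3 /rot12 /rot2 /=; rewrite !addrA; congr (_ + _).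
  by rewrite -[RHS]mul1r -cs; ring.
- exact: measurable_rot12.
- by move=> A; exact: lebesgue3_rot12.
Qed.

Lemma rot_kill (y z : R) : exists c s, [/\ c ^+ 2 + s ^+ 2 = 1, s * y + c * z = 0
  & c * y - s * z = Num.sqrt (y ^+ 2 + z ^+ 2)].
Proof.
set r := Num.sqrt _; have r2 : r ^+ 2 = y ^+ 2 + z ^+ 2.
  by rewrite sqr_sqrtr // addr_ge0 // sqr_ge0.
have [r0|r0] := eqVneq r 0.
  exists 1, 0; split; first by ring.
    by rewrite r0 in r2; nra.
  by rewrite r0 in r2 *; nra.
exists (y / r), (- z / r); split.
- rewrite !exprMn sqrrN -mulrDl -r2 exprVn divff //; exact: expf_neq0.
- by field.
- have -> : y / r * y - - z / r * z = (y ^+ 2 + z ^+ 2) / r by field.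
  by rewrite -r2 expr2 mulfK.
Qed.

(** Euler angles: one coordinate is killed at a time. *)
Lemma isometry_to_axis a : exists2 g, vol_isometry g & g a = (Num.sqrt (dot3 a a), (0, 0)).
Proof.
case: a => a1 [a2 a3].
have [c [s [cs h1 h2]]] := rot_kill a2 a3.
set r := Num.sqrt _ in h2.
have [c' [s' [cs' h1' h2']]] := rot_kill a1 r.
exists (rot12 c' s' \o rot23 c s).
  apply: vol_isometry_comp; [exact: rot12_isometry|exact: rot23_isometry].
rewrite /rot12 /rot23 /rot2 /= h1 h2 h1' h2' /r /dot3 /=.
by rewrite sqr_sqrtr ?addr_ge0 ?sqr_ge0 // !expr2.
Qed.

(** A pair of unit vectors is determined up to rotation by its scalar product, so
the measure of the normals that separate them depends on their angle only. *)
Lemma isometry_to_plane a b : dot3 a a = 1 -> dot3 b b = 1 ->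
  exists g, [/\ vol_isometry g, g a = (1, (0, 0)) &
    g b = (dot3 a b, (Num.sqrt (1 - dot3 a b ^+ 2), 0))].
Proof.
move=> a1 b1; have [g ig ga] := isometry_to_axis a.
rewrite a1 sqrtr1 in ga; have [_ _ dg] := ig.
case gb : (g b) => [b1' [b2 b3]].
have [c [s [cs h1 h2]]] := rot_kill b2 b3.
(* A rotation about the first axis fixes the image of [a] and brings that of [b]
   into the plane of the first two coordinates. *)
have e1 : b1' = dot3 a b by rewrite -dg ga gb /dot3 /=; ring.
have e2 : b1' ^+ 2 + (b2 ^+ 2 + b3 ^+ 2) = 1 by rewrite -b1 -dg gb /dot3 /=; ring.
exists (rot23 c s \o g); split.
- exact: vol_isometry_comp (rot23_isometry cs) ig.
- by rewrite /= ga /rot23 /rot2 /= !mulr0 subr0 addr0.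
- rewrite /= gb /rot23 /rot2 /= h1 h2 e1; congr (_, (Num.sqrt _, _)).
  by rewrite -e1 -e2; ring.
Qed.

(** Up to rotation, the plane is a coordinate plane. *)
Lemma vol_plane0 a : a <> (0, (0, 0)) -> vol (plane a) = 0%E.
Proof.
move=> a0; have [g [mg vg dg] ga] := isometry_to_axis a.
have r0 : Num.sqrt (dot3 a a) != 0.
  apply/eqP => r0; apply: a0; have : dot3 a a <= 0 by rewrite -sqrtr_eq0 r0.
  case: a {ga r0} => [a1 [a2 a3]]; rewrite /dot3 /= => h.
  have -> : a1 = 0 by nra.
  have -> : a2 = 0 by nra.
  by have -> : a3 = 0 by nra.
have -> : plane a = g @^-1` plane (g a).
  by apply/seteqP; split => n; rewrite /plane /= dg.
rewrite vg; last exact: measurable_plane.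
rewrite ga; set r := Num.sqrt _ in r0 *.
have -> : plane (r, (0, 0)) = [set 0] `*` setT.
  apply/seteqP; split => -[x [y z]]; rewrite /plane /dot3 /=.
    by rewrite !mulr0 !addr0 => /eqP; rewrite mulf_eq0 (negPf r0) orbF => /eqP.
  by move=> [-> _]; ring.
by rewrite -setXTT vol_box // lebesgue_measure_set1 mul0e.
Qed.

Definition sep_volume a b := fine (vol (ball3 `&` sep a b)).

Lemma measurable_ball_sep a b : measurable (ball3 `&` sep a b).
Proof. by apply: measurableI; [exact: measurable_ball3|exact: measurable_sep]. Qed.

Lemma ball_sep_fin a b : vol (ball3 `&` sep a b) \is a fin_num.
Proof.
rewrite ge0_fin_numE //; apply: (@le_lt_trans _ _ (vol ball3)).
  apply: le_measure; rewrite ?inE; [exact: measurable_ball_sep|exact: measurable_ball3|].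
  exact: subIsetl.
by rewrite -ge0_fin_numE //; exact: vol_ball3_fin.
Qed.

Lemma sep_volume_isometry g a b : vol_isometry g -> sep_volume (g a) (g b) = sep_volume a b.
Proof.
move=> [mg vg dg]; rewrite /sep_volume -vg; last exact: measurable_ball_sep.
congr (fine (vol _)); apply/seteqP; split => n; by rewrite /ball3 /sep /= !dg.
Qed.

End Crofton.

(** * Crofton's inequality for finitely many chords *)

Lemma ler_sum_mem (R : numDomainType) (I : eqType) (s : seq I) (F G : I -> R) :
  (forall i, i \in s -> F i <= G i) -> \sum_(i <- s) F i <= \sum_(i <- s) G i.
Proof. by move=> FG; rewrite big_seq [leRHS]big_seq; exact: ler_sum. Qed.

Section CroftonBound.
Context {R : realType}.
Local Notation T1 := (measurableTypeR R).
Local Notation vec := (T1 * (T1 * T1))%type.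
Local Notation vol := (@lebesgue3 R).
Implicit Types a b n : vec.

Definition ballvol : R := fine (vol ball3).

Lemma ballvolE : ballvol%:E = vol ball3.
Proof. by rewrite fineK // vol_ball3_fin. Qed.

Lemma ballvol_gt0 : 0 < ballvol.
Proof. by rewrite -lte_fin ballvolE vol_ball3_gt0. Qed.

(** On the circle, the antipode of the point at angle 0 is a combination of the
points at angles [al *+ k] and [al *+ k.+1]; the coefficients are nonnegative
when [pi] lies between these two angles. *)
Lemma sin_chord (al x y : R) (k : nat) :
  sin al * (x * cos pi + y * sin pi) =
  sin (al *+ k.+1 - pi) * (x * cos (al *+ k) + y * sin (al *+ k)) +
  sin (pi - al *+ k) * (x * cos (al *+ k.+1) + y * sin (al *+ k.+1)).
Proof.
rewrite !sinB cospi sinpi mulrSr sinD cosD.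
set c := cos (al *+ k); set s := sin (al *+ k).
have cs : c ^+ 2 + s ^+ 2 = 1 by exact: cos2Dsin2.
transitivity (- sin al * x * (c ^+ 2 + s ^+ 2)); last by ring.
by rewrite cs; ring.
Qed.

(** The great circle spanned by [a] and [b] is divided into steps of angle
[alpha], starting at [a], until the antipode of [a] is passed, which takes at most
[1 + pi / alpha] steps. A normal that is orthogonal to none of the division points
changes sign along one of the steps, and all steps have the same measure. *)
Lemma sep_volume_lune a b : dot3 a a = 1 -> dot3 b b = 1 -> -1 < dot3 a b <= 1 ->
  acos (dot3 a b) * ballvol <= (pi + acos (dot3 a b)) * sep_volume a b.
Proof.
move=> a1 b1 /andP[d1 d2]; set al := acos _.
have al_ge0 : 0 <= al by apply: acos_ge0; rewrite d2 ltW.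
have al_ltpi : al < pi by apply: acos_ltpi; rewrite d1.
have sepvol_ge0 (u v : vec) : 0 <= sep_volume u v by rewrite /sep_volume fine_ge0.
have [al0|al_neq0] := eqVneq al 0.
  by rewrite al0 addr0 mul0r mulr_ge0 ?pi_ge0.
have al_gt0 : 0 < al by rewrite lt_neqAle eq_sym al_neq0.
have sin_gt0 : 0 < sin al by rewrite sin_gt0_pi // al_gt0.
pose v k : vec := (cos (al *+ k), (sin (al *+ k), 0)).
have vE k : sep_volume (v k) (v k.+1) = sep_volume a b.
  have [g [ig ga gb]] := isometry_to_plane a1 b1.
  rewrite -(sep_volume_isometry a b ig).
  rewrite -(sep_volume_isometry (g a) (g b) (rot12_isometry (cos2Dsin2 (al *+ k)))).
  have dom : -1 <= dot3 a b <= 1 by rewrite d2 ltW.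
  have cE : cos al = dot3 a b by rewrite /al acosK // in_itv.
  have sE : sin al = Num.sqrt (1 - dot3 a b ^+ 2) by rewrite /al sin_acos.
  have -> : v k = rot12 (cos (al *+ k)) (sin (al *+ k)) (g a).
    rewrite ga /v /rot12 /rot2 /= !mulr0 !mulr1 subr0 addr0 //.
  have -> : v k.+1 = rot12 (cos (al *+ k)) (sin (al *+ k)) (g b).
    rewrite gb -sE -cE /v /rot12 /rot2 /= mulrSr cosD sinD.
    by congr (_, (_, _)); rewrite addrC [_ * cos al]mulrC.
  by [].
(* The step from [v K] to [v K.+1] passes the antipode of [a]. *)
pose K := Num.truncn (pi / al).
have /andP[K1 K2] : K%:R <= pi / al < K.+1%:R.
  by apply: truncn_itv; rewrite divr_ge0 // pi_ge0.
have K1' : al *+ K <= pi by rewrite -mulr_natr mulrC -ler_pdivlMr.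
have K2' : pi < al *+ K.+1 by rewrite -mulr_natr mulrC -ltr_pdivrMr.
have cover n : ball3 n -> [\/ exists2 k, (k < K.+2)%N & plane (v k) n |
    exists2 k, (k < K.+1)%N & sep (v k) (v k.+1) n].
  move=> _; apply: contrapT => /not_orP[h1 h2].
  case: n h1 h2 => [x [y z]] h1 h2.
  pose h k := x * cos (al *+ k) + y * sin (al *+ k).
  have hE k : dot3 (x, (y, z)) (v k) = h k by rewrite /dot3 /= mulr0 addr0.
  have pos k : (k < K.+2)%N -> 0 < h 0%N * h k.
    elim: k => [|k IHk] kK.
      rewrite -expr2 exprn_even_gt0 //=; apply/eqP => h0; apply: h1.
      by exists 0%N => //; rewrite /plane /= hE.
    have hk := IHk (ltnW kK).
    rewrite ltNge; apply/negP => hk'.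
    have hk1 : h k.+1 != 0.
      by apply/eqP => hk1; apply: h1; exists k.+1 => //; rewrite /plane /= hE.
    have hk1' : 0 < h k.+1 ^+ 2 by rewrite exprn_even_gt0.
    have h00 : 0 < h 0%N ^+ 2.
      rewrite exprn_even_gt0 //=; apply/eqP => h0.
      by rewrite h0 mul0r ltxx in hk.
    apply: h2; exists k => //; rewrite /sep /= !hE.
    have hh : h 0%N * h k.+1 < 0.
      rewrite lt_neqAle hk' andbT mulf_neq0 //.
      by apply/eqP => h0; rewrite h0 mul0r ltxx in hk.
    rewrite -(pmulr_rlt0 _ h00).
    have -> : h 0%N ^+ 2 * (h k * h k.+1) = (h 0%N * h k) * (h 0%N * h k.+1) by ring.
    by rewrite pmulr_rlt0.
  have p0 := pos 0%N isT; have p1 := pos K (leqnSn _); have p2 := pos K.+1 (leqnn _).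
  (* All signs being equal to that of [h 0], the value at the antipode has that sign
     as well, but it is [- h 0]. *)
  have E := sin_chord al x y K.
  rewrite cospi sinpi -/(h K) -/(h K.+1) in E.
  have h0x : h 0%N = x by rewrite /h mulr0n cos0 sin0; ring.
  have s1 : 0 <= sin (al *+ K.+1 - pi).
    apply: sin_ge0_pi; rewrite subr_ge0 ltW //= mulrSr lerBlDr.
    by apply: lerD => //; exact: ltW.
  have s2 : 0 <= sin (pi - al *+ K).
    apply: sin_ge0_pi; rewrite subr_ge0 K1' /= gerBl.
    by rewrite mulrn_wge0.
  have := congr1 ( *%R x) E.
  have r1 := mulr_ge0 s1 (ltW p1); have r2 := mulr_ge0 s2 (ltW p2).
  rewrite h0x in p0 r1 r2; move=> E'.
  have : 0 < sin al * (x * x) by rewrite mulr_gt0.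
  by nra.
pose F (i : 'I_K.+2 + 'I_K.+1) : set vec := match i with
  | inl k => plane (v k) | inr k => ball3 `&` sep (v k) (v k.+1) end.
have : (vol ball3 <= \sum_(i <- enum (('I_K.+2 + 'I_K.+1)%type : finType)) vol (F i))%E.
  apply: measure_cover_seq; last 2 first.
  - exact: measurable_ball3.
  - move=> n bn; case: (cover n bn) => [[k kK kn]|[k kK kn]].
      by exists (inl (Ordinal kK)) => //; rewrite mem_enum.
    by exists (inr (Ordinal kK)) => //; rewrite mem_enum.
  - by move=> [k|k]; [exact: measurable_plane|exact: measurable_ball_sep].
rewrite big_enum /= big_sumType /= big1 => [|k _]; last first.
  apply: vol_plane0 => -[cs0 sn0]; have := cos2Dsin2 (al *+ k).
  by rewrite cs0 sn0; lra.
rewrite add0e (eq_bigr (fun=> (sep_volume a b)%:E)) => [|k _]; last first.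
  by rewrite -(vE k) /sep_volume fineK // ball_sep_fin.
rewrite sumEFin sumr_const card_ord -ballvolE lee_fin => le.
have le' : al * ballvol <= al * (sep_volume a b *+ K.+1) by rewrite ler_pM2l.
apply: le_trans le' _; rewrite mulrnAr -mulrnAl ler_wpM2r // mulrSr.
by rewrite lerD2r.
Qed.

(** Integrate over the ball the number of pairs that are separated by the great
circle with normal [n]; the exceptional normals form a null set. *)
Lemma sum_sep_volume_le (s : seq (vec * vec)) (l : seq vec) (D : nat) :
  (forall p, p \in l -> p <> (0, (0, 0))) ->
  (forall n, (forall p, p \in l -> dot3 n p <> 0) ->
    (count (fun ab => dot3 n ab.1 * dot3 n ab.2 < 0)%R s <= D)%N) ->
  \sum_(ab <- s) sep_volume ab.1 ab.2 <= D%:R * ballvol.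
Proof.
move=> l0 sD; pose N : set vec := \big[setU/set0]_(p <- l) plane p.
have mN : measurable N by apply: bigsetU_measurable => p _; exact: measurable_plane.
have NP n : ~ N n -> forall p, p \in l -> dot3 n p <> 0.
  move=> Nn p pl np; apply: Nn; rewrite /N -bigcup_seq; exists p => //.
have vN : vol N = 0%E.
  have vN0 : (vol N <= \sum_(p <- l) vol (plane p))%E.
    apply: measure_cover_seq => //; first exact: measurable_plane.
    by move=> n; rewrite /N -bigcup_seq => -[p pl np]; exists p.
  apply/eqP; rewrite eq_le measure_ge0 andbT; apply: le_trans vN0 _.
  by rewrite big1_seq // => p /= pl; apply: vol_plane0; exact: l0.
pose B' := ball3 `\` N.
have mB' : measurable B' by apply: measurableD => //; exact: measurable_ball3.
rewrite -lee_fin -sumEFin EFinM [X in (_ * X)%E]ballvolE.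
apply: (@le_trans _ _ (\sum_(ab <- s) \int[vol]_(n in B') (\1_(sep ab.1 ab.2) n)%:E)%E).
  apply: lee_sum => ab _; rewrite (fineK (ball_sep_fin _ _)).
  rewrite (integral_indic _ mB' (measurable_sep ab.1 ab.2)).
  have mS : measurable (sep ab.1 ab.2 `&` B').
    by apply: measurableI => //; exact: measurable_sep.
  rewrite -[leRHS]adde0 -vN; apply: le_trans (measureU2 _ mS mN).
  apply: le_measure; rewrite ?inE; first exact: measurable_ball_sep.
    exact: measurableU mS mN.
  by move=> n [bn sn]; have [Nn|Nn] := pselect (N n); [right|left].
pose f (ab : vec * vec) n : \bar R := (\1_(sep ab.1 ab.2) n)%:E.
have mi (ab : vec * vec) : measurable_fun B' (f ab).
  by apply/measurable_EFinP/measurable_funTS; apply: measurable_indic; exact: measurable_sep.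
rewrite -(ge0_integral_sum vol mB' mi); last by move=> ab n _; rewrite lee_fin.
apply: (@le_trans _ _ (\int[vol]_(n in B') (cst D%:R%:E) n)%E).
  apply: ge0_le_integral => //.
  - by move=> n _; apply: sume_ge0 => ab _; rewrite lee_fin.
  - by apply: emeasurable_sum => ab; exact: mi.
  - move=> n [_ /NP /sD]; rewrite sumEFin lee_fin -(ler_nat R) => h.
    apply: le_trans h; rewrite -sum1_count natr_sum [leRHS]big_mkcond /=.
    apply: ler_sum => ab _; rewrite indicE /sep; case: ifP => h.
      by rewrite mem_set.
    by rewrite memNset //= h.
rewrite (integral_cst vol mB'); apply: lee_wpmul2l; first by rewrite lee_fin.
apply: le_measure; rewrite ?inE; [exact: mB'|exact: measurable_ball3|].
by move=> n [].
Qed.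

(** The number [D] stands for the maximal number of intersections with a great
circle whose normal avoids the planes orthogonal to the points of [l]. The constant
[pi + eta] tends to the sharp [pi] as the mesh [eta] of the chords tends to 0. *)
Lemma crofton_bound (s : seq (vec * vec)) (l : seq vec) (D : nat) (eta : R) :
  0 <= eta < pi ->
  (forall ab, ab \in s -> [/\ dot3 ab.1 ab.1 = 1, dot3 ab.2 ab.2 = 1,
     -1 <= dot3 ab.1 ab.2 <= 1 & acos (dot3 ab.1 ab.2) <= eta]) ->
  (forall p, p \in l -> p <> (0, (0, 0))) ->
  (forall n, (forall p, p \in l -> dot3 n p <> 0) ->
    (count (fun ab => dot3 n ab.1 * dot3 n ab.2 < 0)%R s <= D)%N) ->
  \sum_(ab <- s) acos (dot3 ab.1 ab.2) <= D%:R * (pi + eta).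
Proof.
move=> /andP[e0 epi] sP l0 sD; have h := sum_sep_volume_le l0 sD.
rewrite -(ler_pM2r ballvol_gt0) mulr_suml.
apply: (@le_trans _ _ ((pi + eta) * \sum_(ab <- s) sep_volume ab.1 ab.2)); last first.
  rewrite [leRHS]mulrAC [leRHS]mulrC; apply: ler_wpM2l => //.
  by rewrite addr_ge0 ?pi_ge0.
rewrite mulr_sumr; apply: ler_sum_mem => -[a b] /sP[/= a1 b1 d ae].
have [d1 d2] := andP d.
have dN1 : -1 < dot3 a b.
  rewrite lt_neqAle d1 andbT; apply/eqP => dE.
  by move: ae; rewrite -dE acosN1 leNgt epi.
apply: le_trans (sep_volume_lune a1 b1 _) _; first by rewrite dN1.
apply: ler_wpM2r; first by rewrite /sep_volume fine_ge0.
by rewrite lerD2l.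
Qed.

End CroftonBound.

(** * Intersections with a great circle *)

Section TopCoef.
Context {F : comNzRingType}.
Implicit Types (P Q : {poly F}) (a b : F) (m n : nat).

(** The degree bound comes with the coefficient that it singles out, possibly 0;
in this form the statement is stable under products and sums. *)
Definition top_coef P n a := (size P <= n.+1)%N /\ P`_n = a.

Lemma top_coefM P Q m n a b :
  top_coef P m a -> top_coef Q n b -> top_coef (P * Q) (m + n)%N (a * b).
Proof.
move=> [sP <-] [sQ <-]; split.
  apply: leq_trans (size_polyMleq P Q) _.
  by rewrite -ltnS (leq_trans (leqSpred _)) // -addnS; have := leq_add sP sQ; lia.
rewrite coefM.
have mS : (m < (m + n).+1)%N by rewrite ltnS leq_addr.
rewrite (bigD1 (Ordinal mS)) //= addKn big1 ?addr0 // => i.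
rewrite -val_eqE /= neq_ltn => /orP[im|mi].
  by rewrite [Q`__]nth_default ?mulr0 //; apply: leq_trans sQ _; lia.
by rewrite [P`__]nth_default ?mul0r //; apply: leq_trans sP _.
Qed.

Lemma top_coefX P n a k : top_coef P n a -> top_coef (P ^+ k) (n * k)%N (a ^+ k).
Proof.
move=> tP; elim: k => [|k IHk]; first by rewrite muln0 !expr0; split; rewrite ?size_poly1 ?coef1.
by rewrite !exprS mulnS; exact: top_coefM.
Qed.

Lemma top_coefD P Q n a b :
  top_coef P n a -> top_coef Q n b -> top_coef (P + Q) n (a + b).
Proof.
move=> [sP <-] [sQ <-]; split; last by rewrite coefD.
by apply: leq_trans (size_polyD _ _) _; rewrite geq_max sP.
Qed.

Lemma top_coefZ P n a c : top_coef P n a -> top_coef (c *: P) n (c * a).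
Proof.
move=> [sP <-]; split; last by rewrite coefZ.
exact: leq_trans (size_scale_leq _ _) _.
Qed.

Lemma top_coef_sum (I : Type) (r : seq I) (f : I -> {poly F}) n (g : I -> F) :
  (forall i, top_coef (f i) n (g i)) ->
  top_coef (\sum_(i <- r) f i) n (\sum_(i <- r) g i).
Proof.
move=> fg; elim: r => [|i r IHr]; first by rewrite !big_nil; split; rewrite ?size_poly0 ?coef0.
by rewrite !big_cons; exact: top_coefD.
Qed.

Lemma top_coef_linear a b : top_coef (a *: 'X + b%:P) 1 a.
Proof.
split; last by rewrite coefD coefZ coefX coefC mulr1 addr0.
apply: leq_trans (size_polyD _ _) _; rewrite geq_max.
rewrite (leq_trans (size_scale_leq _ _)) ?size_polyX //=.
exact: leq_trans (size_polyC_leq1 _) _.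
Qed.

(** For linear polynomials [A] and [B], this is the binary form of degree [d]
associated with [p], restricted to a line. *)
Definition homog (p : {poly F}) (d : nat) (A B : {poly F}) : {poly F} :=
  \sum_(i < d.+1) p`_i *: (A ^+ i * B ^+ (d - i)).

Lemma homog_top (p : {poly F}) d (a b v w : F) : (size p <= d.+1)%N ->
  top_coef (homog p d ((a * b) *: 'X + v%:P) (b *: 'X + w%:P)) d (b ^+ d * p.[a]).
Proof.
move=> sp; rewrite (horner_coef_wide _ sp) mulr_sumr /homog.
apply: top_coef_sum => i.
have id : (i <= d)%N by rewrite -ltnS.
have -> : b ^+ d * (p`_i * a ^+ i) = p`_i * ((a * b) ^+ i * b ^+ (d - i)).
  by rewrite -[in b ^+ d](subnKC id) exprD exprMn; ring.
rewrite -[in X in top_coef _ X](subnKC id); apply: top_coefZ.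
by apply: top_coefM; rewrite -[X in top_coef _ X]mul1n; apply: top_coefX;
  exact: top_coef_linear.
Qed.

Lemma homog_horner (p : {poly F}) d (A B : {poly F}) (t z : F) : (size p <= d.+1)%N ->
  A.[t] = B.[t] * z -> (homog p d A B).[t] = B.[t] ^+ d * p.[z].
Proof.
move=> sp AB; rewrite (horner_coef_wide _ sp) mulr_sumr horner_sum.
apply: eq_bigr => i _; have id : (i <= d)%N by rewrite -ltnS.
rewrite hornerZ hornerM !horner_exp AB exprMn.
have -> : B.[t] ^+ d = B.[t] ^+ i * B.[t] ^+ (d - i) by rewrite -exprD subnKC.
by ring.
Qed.

End TopCoef.

Section GreatCircleCount.
Local Open Scope complex_scope.
Context {R : realType}.
Local Notation C := R[i].
Implicit Types (p q : {poly C}) (n : R * (R * R)) (z : C).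

Definition stereo3 z : R * (R * R) :=
  let: x +i* y := z in let m := x ^+ 2 + y ^+ 2 in
  (2 * x / (m + 1), (2 * y / (m + 1), (m - 1) / (m + 1))).

(** Where [p] and [q] do not both vanish, this says that [p / q] is real or infinite. *)
Definition real_ratio p q z : bool := p.[z] * conjc q.[z] == conjc p.[z] * q.[z].

(** The Hermitian form of the great circle with normal [n], in the affine
coordinate [z]. *)
Definition circle_form n z : C :=
  let nu := n.1 +i* n.2.1 in
  (conjc nu) * z + nu * conjc z + n.2.2%:C * (z * conjc z - 1).

Lemma circle_formE n z : circle_form n z =
  ((1 + (complex.Re z ^+ 2 + complex.Im z ^+ 2)) * dot3 n (stereo3 z) : R)%:C.
Proof.
case: n => n1 [n2 n3]; case: z => x y.
rewrite /circle_form /dot3 /= /real_complex_def.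
have m0 : 0 < x ^+ 2 + y ^+ 2 + 1 by rewrite ltr_wpDl // addr_ge0 // sqr_ge0.
simpc; apply/eqP; rewrite eq_complex /=; apply/andP; split; apply/eqP; last by ring.
by field; apply: lt0r_neq0.
Qed.

Lemma circle_form_eq0 n z : (circle_form n z == 0) = (dot3 n (stereo3 z) == 0).
Proof.
rewrite circle_formE -(inj_eq (@complexI R)) /= rmorphM mulf_eq0 /=.
suff /negPf -> : (1 + (complex.Re z ^+ 2 + complex.Im z ^+ 2))%:C != 0 by [].
by rewrite (inj_eq (@complexI R)) gt_eqF // ltr_pwDl // addr_ge0 // sqr_ge0.
Qed.

(** The point of the great circle with normal [n] through [z0] that has parameter
[t] is [(c * z0 - 1) / (c + conjc z0)] where [c = t * circle_param n z0]: in
homogeneous coordinates this is a combination of [z0] and its antipode, which is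
on the circle exactly when [t] is real. The point [z0] itself has parameter infinity. *)
Definition circle_param n z0 : C :=
  let nu := n.1 +i* n.2.1 in
  'i%C * (nu * conjc z0 ^+ 2 - conjc nu - 2 * n.2.2%:C * conjc z0).

(** The square of the modulus of [circle_param n z0] and the square of
[circle_form n z0] add up to a positive multiple of the squared norm of [n]. *)
Lemma circle_param_neq0 n z0 : n <> (0, (0, 0)) -> circle_form n z0 = 0 ->
  circle_param n z0 != 0.
Proof.
case: n => n1 [n2 n3]; case: z0 => x y n0.
rewrite /circle_param /circle_form /real_complex_def; simpc => -[h _].
apply/negP; rewrite eq_complex /= => /andP[/eqP e1 /eqP e2]; apply: n0.
set h' := (LHS) in h; set e1' := (LHS) in e1; set e2' := (LHS) in e2.
have E : (1 + (x ^+ 2 + y ^+ 2)) ^+ 2 * (n1 ^+ 2 + (n2 ^+ 2 + n3 ^+ 2)) =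
  e1' ^+ 2 + e2' ^+ 2 + h' ^+ 2 by rewrite /h' /e1' /e2'; ring.
have : n1 ^+ 2 + (n2 ^+ 2 + n3 ^+ 2) = 0.
  move: E; rewrite h e1 e2 !expr0n /= !addr0 => /eqP; rewrite mulf_eq0 expf_eq0 /=.
  rewrite gt_eqF ?ltr_pwDl ?addr_ge0 ?sqr_ge0 //= => /eqP //.
move=> e; have -> : n1 = 0 by nra.
have -> : n2 = 0 by nra.
by have -> : n3 = 0 by nra.
Qed.

(** In the parameter of [circle_param], the condition [real_ratio] is the
vanishing of a polynomial of degree at most [d + d]. Its coefficient of degree
[d + d] is a nonzero multiple of the value at the parameter infinity, which is
the point [z0], and hence nonzero. *)
Lemma great_circle_count p q d n z0 (s : seq C) :
  (size p <= d.+1)%N -> (size q <= d.+1)%N -> n <> (0, (0, 0)) ->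
  dot3 n (stereo3 z0) = 0 -> ~~ real_ratio p q z0 -> uniq s ->
  (forall z, z \in s -> real_ratio p q z /\ dot3 n (stereo3 z) = 0) ->
  (size s <= d + d)%N.
Proof.
move=> sp sq n0 /eqP; rewrite -circle_form_eq0 => /eqP h0 Ez0 us sP.
have k0 := circle_param_neq0 n0 h0.
set k := circle_param n z0 in k0.
pose c z := ((conjc z0) * z + 1) / (z0 - z).
pose t z := c z / k.
pose A : {poly C} := (z0 * k) *: 'X + (- 1)%:P.
pose B : {poly C} := k *: 'X + ((conjc z0))%:P.
pose cj := map_poly (@conjc R).
pose P := homog p d A B; pose Q := homog q d A B.
pose G := P * cj Q - cj P * Q.
have tP : top_coef P d (k ^+ d * p.[z0]) by exact: homog_top.
have tQ : top_coef Q d (k ^+ d * q.[z0]) by exact: homog_top.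
have tcj (S : {poly C}) a : top_coef S d a -> top_coef (cj S) d (conjc a).
  by move=> [sS <-]; split; rewrite ?coef_map ?size_map_poly.
(* Up to a nonzero factor, the top coefficient of [G] is the value at the point [z0]. *)
have tG : top_coef G (d + d)
    (k ^+ d * conjc (k ^+ d) * (p.[z0] * conjc q.[z0] - conjc p.[z0] * q.[z0])).
  rewrite (_ : _ * _ = (k ^+ d * p.[z0]) * conjc (k ^+ d * q.[z0]) +
     (- 1) * ((conjc (k ^+ d * p.[z0])) * (k ^+ d * q.[z0]))); last by rewrite !rmorphM /=; ring.
  rewrite /G -scaleN1r; apply: top_coefD; first by apply: top_coefM => //; exact: tcj.
  by apply: top_coefZ; apply: top_coefM => //; exact: tcj.
have G0 : G != 0.
  apply/eqP => G0; move: tG; rewrite G0 => -[_]; rewrite coef0 => /esym/eqP.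
  rewrite !mulf_eq0 conjc_eq0 expf_eq0 (negPf k0) andbF /= subr_eq0.
  by move: Ez0; rewrite /real_ratio => /negPf ->.
have sz z : z \in s -> z0 - z != 0.
  move=> /sP[Ez _]; apply/eqP => /eqP; rewrite subr_eq0 => /eqP zz.
  by rewrite -zz in Ez; rewrite Ez in Ez0.
have m0 : 1 + z0 * conjc z0 != 0.
  by rewrite -sqr_normc gt_eqF // ltr_pwDl // exprn_ge0.
have treal z : z \in s -> (conjc (t z)) = t z.
  move=> zs; have [_ /eqP] := sP z zs; rewrite -circle_form_eq0 => /eqP hz.
  have z0z := sz z zs.
  have E1 : (conjc ((conjc z0) * z + 1)) = z0 * conjc z + 1.
    by rewrite rmorphD rmorphM rmorph1 /= conjcK.
  have E2 : (conjc (z0 - z)) = conjc z0 - conjc z by rewrite rmorphB.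
  have E3 : (conjc k) = - 'i%C * ((conjc (n.1 +i* n.2.1)) * z0 ^+ 2 - (n.1 +i* n.2.1) - 2 * n.2.2%:C * z0).
    rewrite /k /circle_param; case: (z0) => x y; case: (n) => n1 [n2 n3].
    by rewrite /real_complex_def /=; simpc; congr (_ +i* _); ring.
  have z0z' : (conjc z0) - conjc z != 0 by rewrite -E2 conjc_eq0.
  have k0' : (conjc k) != 0 by rewrite conjc_eq0.
  have tE : (conjc (t z)) = (z0 * conjc z + 1) / ((conjc z0) - conjc z) / (conjc k).
    by rewrite /t /c 2!rmorphM 2!fmorphV /= E1 E2.
  rewrite tE /t /c.
  have X : (z0 * conjc z + 1) * ((z0 - z) * k) = ((conjc z0) * z + 1) * (((conjc z0) - conjc z) * conjc k).
    apply/eqP; rewrite -subr_eq0; apply/eqP; rewrite E3 /k /circle_param.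
    transitivity ('i%C * ((1 + z0 * conjc z0) ^+ 2 * circle_form n z -
      ((1 + conjc z0 * z) * (1 + z0 * conjc z) - (z0 - z) * ((conjc z0) - conjc z)) * circle_form n z0)).
      by rewrite /circle_form; ring.
    by rewrite hz h0 !mulr0 subrr mulr0.
  rewrite -!mulrA -!invfM; apply/eqP; rewrite eqr_div; first by rewrite X.
    by apply: mulf_neq0.
  by apply: mulf_neq0.
have tinj : {in s &, injective t}.
  move=> z w zs ws; rewrite /t => /(mulIf (invr_neq0 k0)); rewrite /c => /eqP.
  rewrite eqr_div ?sz // => /eqP e; apply/eqP; rewrite -subr_eq0.
  have : (1 + z0 * conjc z0) * (z - w) = 0.
    transitivity (((conjc z0) * z + 1) * (z0 - w) - ((conjc z0) * w + 1) * (z0 - z)); first by ring.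
    by rewrite e subrr.
  by move/eqP; rewrite mulf_eq0 (negPf m0).
have rootG z : z \in s -> root G (t z).
  move=> zs; have [/eqP Ez _] := sP z zs.
  have tk : t z * k = c z by rewrite /t divfK.
  have z0z := sz z zs.
  have AB : A.[t z] = B.[t z] * z.
    have -> : A.[t z] = z0 * c z - 1 by rewrite hornerD hornerZ hornerX hornerC -mulrA [k * _]mulrC tk.
    have -> : B.[t z] = c z + conjc z0 by rewrite hornerD hornerZ hornerX hornerC [k * _]mulrC tk.
    by rewrite /c; field.
  have PE := homog_horner sp AB; have QE := homog_horner sq AB.
  have cjE (S : {poly C}) : (cj S).[t z] = conjc S.[t z].
    by rewrite -{1}(treal z zs) horner_map.
  rewrite /root /G !hornerE !cjE PE QE !rmorphM /= subr_eq0; apply/eqP.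
  transitivity (B.[t z] ^+ d * conjc (B.[t z] ^+ d) * (p.[z] * conjc q.[z])); first by ring.
  by rewrite Ez; ring.
have := max_poly_roots G0 (rs := [seq t z | z <- s]) _ _.
rewrite size_map => h; rewrite -ltnS; apply: leq_trans (h _ _) _.
- by apply/allP => _ /mapP[z zs ->]; exact: rootG.
- by rewrite map_inj_in_uniq.
- by have [] := tG.
Qed.

End GreatCircleCount.

(** * Stereographic projection and generic great circles *)

Lemma bounded_uniq_finite (T : eqType) (P : pred T) (N : nat) :
  (forall s, uniq s -> all P s -> (size s <= N)%N) ->
  exists s : seq T, forall x, P x -> x \in s.
Proof.
move=> bnd; apply: contrapT => /forallNP H.
have : forall k, exists s, [/\ uniq s, all P s & size s = k].
  elim=> [|k [s [us Ps sk]]]; first by exists [::].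
  have /existsNP[x /not_implyP[Px /negP xs]] := H s.
  by exists (x :: s); rewrite /= us xs Px Ps sk.
by move=> /(_ N.+1)[s [us Ps sN]]; have := bnd s us Ps; rewrite sN ltnn.
Qed.

Section Stereo.
Local Open Scope complex_scope.
Context {R : realType}.
Local Notation C := R[i].
Implicit Types (p q : {poly C}) (n u v w : R * (R * R)) (x z : C).

Lemma normsq_gt0 (x y : R) : 0 < x ^+ 2 + y ^+ 2 + 1.
Proof. by rewrite ltr_wpDl // addr_ge0 // sqr_ge0. Qed.

Lemma stereo3_unit z : dot3 (stereo3 z) (stereo3 z) = 1.
Proof.
case: z => x y; rewrite /dot3 /=; have := lt0r_neq0 (normsq_gt0 x y).
by move=> m0; field.
Qed.

Lemma stereo3_surj v : dot3 v v = 1 -> v <> (0, (0, 1)) -> exists z, stereo3 z = v.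
Proof.
case: v => [a [b c]]; rewrite /dot3 /= => v1 vN.
have c1 : c != 1.
  apply/eqP => c1; apply: vN; rewrite c1 in v1 *.
  have -> : a = 0 by nra.
  by have -> : b = 0 by nra.
have c1' : 1 - c != 0 by rewrite subr_eq0 eq_sym.
have cc : a ^+ 2 + b ^+ 2 = (1 - c) * (1 + c) by nra.
exists ((a / (1 - c)) +i* (b / (1 - c))) => /=.
have -> : (a / (1 - c)) ^+ 2 + (b / (1 - c)) ^+ 2 = (1 + c) / (1 - c).
  by transitivity ((a ^+ 2 + b ^+ 2) / (1 - c) ^+ 2); [field|rewrite cc; field].
have s0 : (1 + c) / (1 - c) + 1 = 2 / (1 - c) by field.
rewrite s0; congr (_, (_, _)); field; rewrite ?c1' //.
Qed.

Lemma spherical_distE z (w : C) :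
  spherical_dist (Some z) (Some w) = acos (dot3 (stereo3 z) (stereo3 w)).
Proof.
case: z => x y; case: w => x' y'.
by rewrite /spherical_dist !big_ord_recl big_ord0 /= !mxE /= addr0 /dot3.
Qed.

Lemma exists_orthogonal v : exists2 w, w <> (0, (0, 0)) & dot3 w v = 0.
Proof.
case: v => a [b c]; have [/eqP a0|a0] := eqVneq a 0.
  exists (1, (0, 0)); first by case=> /eqP; rewrite oner_eq0.
  by rewrite /dot3 /= (eqP a0); ring.
exists (b, (- a, 0)); last by rewrite /dot3 /=; ring.
by case=> _ /eqP; rewrite oppr_eq0 (negPf a0).
Qed.

Lemma dot3_collinear n v w : w <> (0, (0, 0)) -> dot3 w v = 0 ->
  n.1 * w.2.1 = n.2.1 * w.1 -> n.1 * w.2.2 = n.2.2 * w.1 ->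
  n.2.1 * w.2.2 = n.2.2 * w.2.1 -> dot3 n v = 0.
Proof.
case: n w v => n1 [n2 n3] [w1 [w2 w3]] [v1 [v2 v3]]; rewrite /dot3 /= => w0 wv e1 e2 e3.
have h1 : w1 * (n1 * v1 + (n2 * v2 + n3 * v3)) = 0.
  rewrite (_ : _ * _ = n1 * (w1 * v1 + (w2 * v2 + w3 * v3)) +
    v2 * (n2 * w1 - n1 * w2) + v3 * (n3 * w1 - n1 * w3)); last by ring.
  by rewrite wv e1 e2 !subrr; ring.
have h2 : w2 * (n1 * v1 + (n2 * v2 + n3 * v3)) = 0.
  rewrite (_ : _ * _ = n2 * (w1 * v1 + (w2 * v2 + w3 * v3)) +
    v1 * (n1 * w2 - n2 * w1) + v3 * (n3 * w2 - n2 * w3)); last by ring.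
  by rewrite wv e1 e3 !subrr; ring.
have h3 : w3 * (n1 * v1 + (n2 * v2 + n3 * v3)) = 0.
  rewrite (_ : _ * _ = n3 * (w1 * v1 + (w2 * v2 + w3 * v3)) +
    v1 * (n1 * w3 - n3 * w1) + v2 * (n2 * w3 - n3 * w2)); last by ring.
  by rewrite wv e2 e3 !subrr; ring.
apply/eqP/negPn/negP => k0; apply: w0.
move/eqP: h1; rewrite mulf_eq0 (negPf k0) orbF => /eqP ->.
move/eqP: h2; rewrite mulf_eq0 (negPf k0) orbF => /eqP ->.
by move/eqP: h3; rewrite mulf_eq0 (negPf k0) orbF => /eqP ->.
Qed.

(** The normalized cross product. *)
Lemma exists_common_orthogonal n w :
  [\/ [/\ n.1 * w.2.1 = n.2.1 * w.1, n.1 * w.2.2 = n.2.2 * w.1 &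
  n.2.1 * w.2.2 = n.2.2 * w.2.1] | exists v, [/\ dot3 v v = 1, dot3 n v = 0 & dot3 w v = 0]].
Proof.
case: n w => n1 [n2 n3] [w1 [w2 w3]] /=.
pose a := n2 * w3 - n3 * w2; pose b := n3 * w1 - n1 * w3; pose c := n1 * w2 - n2 * w1.
pose r := a ^+ 2 + (b ^+ 2 + c ^+ 2).
have r_ge0 : 0 <= r by rewrite !addr_ge0 // sqr_ge0.
have [r0|r0] := eqVneq r 0.
  left; have a0 : a = 0 by rewrite /r in r0; nra.
  have b0 : b = 0 by rewrite /r in r0; nra.
  have c0 : c = 0 by rewrite /r in r0; nra.
  by move: a0 b0 c0; rewrite /a /b /c => ? ? ?; split; lra.
right; pose s := Num.sqrt r.
have s2 : s ^+ 2 = r by rewrite sqr_sqrtr.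
have s0 : s != 0 by rewrite -sqrf_eq0 s2.
exists (a / s, (b / s, c / s)); split; rewrite /dot3 /=.
- rewrite (_ : _ + _ = r / s ^+ 2); last by rewrite /r; field.
  by rewrite s2 divff.
- by rewrite /a /b /c; field.
- by rewrite /a /b /c; field.
Qed.

(** If [w] is the normal of a great circle through [x], then finitely many points
of that great circle satisfy [real_ratio]; the list [l] consists of these and of
the north pole, the image of infinity. A great circle whose normal is orthogonal to
none of them meets the great circle of [w] in a point outside the list. *)
Lemma generic_great_circle p q d x :
  (size p <= d.+1)%N -> (size q <= d.+1)%N -> ~~ real_ratio p q x ->
  exists l : seq (R * (R * R)), (forall v, v \in l -> v <> (0, (0, 0))) /\
    forall n, (forall v, v \in l -> dot3 n v <> 0) -> n <> (0, (0, 0)) /\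
      exists2 z, dot3 n (stereo3 z) = 0 & ~~ real_ratio p q z.
Proof.
(* The great circle with normal [w] passes through [x]. *)
move=> sp sq Ex; have [w w0 wx] := exists_orthogonal (stereo3 x).
have [|L HL] := @bounded_uniq_finite _
   [pred z | real_ratio p q z && (dot3 w (stereo3 z) == 0)] (d + d).
  move=> s us /allP sP; apply: (great_circle_count sp sq w0 wx Ex us).
  by move=> z /sP /andP[? /eqP].
exists ((0, (0, 1)) :: [seq stereo3 z | z <- L]); split.
  move=> v; rewrite inE => /orP[/eqP ->|/mapP[z _ ->]].
    by case=> /eqP; rewrite oner_eq0.
  move=> z0; have := stereo3_unit z; rewrite z0 /dot3 /= !mulr0 !addr0 => /esym/eqP.
  by rewrite oner_eq0.
move=> n nl; split.
  by move=> n0; apply: (nl (0, (0, 1))); rewrite ?mem_head // n0 /dot3 /=; ring.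
have [[e1 e2 e3]|[v [v1 nv wv]]] := exists_common_orthogonal n w.
  by exists x => //; exact: dot3_collinear wx e1 e2 e3.
have [||z zv] := @stereo3_surj v => //.
  by move=> vN; apply: (nl v); rewrite // vN mem_head.
exists z; first by rewrite zv.
apply/negP => Ez; apply: (nl (stereo3 z)); last by rewrite zv.
by rewrite inE map_f ?orbT // HL //= Ez zv wv eqxx.
Qed.

End Stereo.

(** * Chords, angles and difference quotients *)

(** With [x = acos d], the chord satisfies [2 - 2 * d = 4 * sin (x / 2) ^+ 2], and
[sin y] lies between [y * cos y] and [y]. *)
Lemma acos_chord (R : realType) (d : R) : -1 <= d <= 1 ->
  acos d ^+ 2 * (1 + d) <= 2 * (2 - 2 * d) /\ 2 - 2 * d <= acos d ^+ 2.
Proof.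
move=> dd; set x := acos d.
have x_ge0 : 0 <= x by exact: acos_ge0.
have x_lepi : x <= pi by exact: acos_lepi.
have dE : d = cos x by rewrite /x acosK // in_itv.
pose y := x / 2.
have xy : x = y + y by rewrite /y -splitr.
have y_ge0 : 0 <= y by rewrite divr_ge0.
have y_lepi : y <= pi / 2 by rewrite ler_pM2r // invr_gt0.
have cs := cos2Dsin2 y.
have d1 : 2 - 2 * d = 4 * sin y ^+ 2 by rewrite dE xy cosD; nra.
have d2 : 1 + d = 2 * cos y ^+ 2 by rewrite dE xy cosD; nra.
have [c /andP[c0 cy] sy] : exists2 c : R, 0 <= c <= y & sin y = cos c * y.
  have [|c cin] := @MVT_segment R sin cos 0 y y_ge0 (fun t _ => is_derive_sin t).
    by apply: continuous_subspaceT => t; exact: continuous_sin.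
  by rewrite sin0 !subr0 => ->; exists c => //; move: cin; rewrite in_itv.
have cosc1 := cos_le1 c.
have cosc0 : 0 <= cos c.
  by apply: cos_ge0_pihalf; rewrite (le_trans cy) // andbT (le_trans _ c0) // oppr_le0 divr_ge0 // pi_ge0.
have cosy0 : 0 <= cos y.
  by apply: cos_ge0_pihalf; rewrite y_lepi andbT (le_trans _ y_ge0) // oppr_le0 divr_ge0 // pi_ge0.
have cosyc : cos y <= cos c.
  have y_pi : y <= pi by rewrite (le_trans y_lepi) // ler_pdivrMr // mulr2n mulrDr mulr1 lerDl pi_ge0.
  rewrite leNgt ltr_cos ?in_itv /= ?c0 ?y_ge0 ?y_pi ?(le_trans cy) //.
  by rewrite -leNgt.
have h1 : 0 <= y ^+ 2 * (1 - cos c ^+ 2).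
  by rewrite mulr_ge0 ?sqr_ge0 // subr_ge0 expr_le1.
have h2 : 0 <= y ^+ 2 * (cos c ^+ 2 - cos y ^+ 2).
  by rewrite mulr_ge0 ?sqr_ge0 // subr_ge0 lerXn2r.
by rewrite d1 d2 xy sy; split; lra.
Qed.

Section DifferenceQuotient.
Context {K : numFieldType}.
Implicit Types (p q : {poly K}) (z : K).

Lemma cvg_horner1 p z0 : (fun zz : K * K => p.[zz.1]) @ (z0, z0) --> p.[z0].
Proof.
elim/poly_ind: p => [|p c IHp].
  by under eq_fun do rewrite horner0; rewrite horner0; exact: cvg_cst.
under eq_fun do rewrite hornerMXaddC.
rewrite hornerMXaddC; apply: cvgD; last exact: cvg_cst.
by apply: cvgM => //; exact: cvg_fst.
Qed.

Lemma cvg_horner2 p z0 : (fun zz : K * K => p.[zz.2]) @ (z0, z0) --> p.[z0].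
Proof.
elim/poly_ind: p => [|p c IHp].
  by under eq_fun do rewrite horner0; rewrite horner0; exact: cvg_cst.
under eq_fun do rewrite hornerMXaddC.
rewrite hornerMXaddC; apply: cvgD; last exact: cvg_cst.
by apply: cvgM => //; exact: cvg_snd.
Qed.

(** By induction on the polynomial; the quotient is a polynomial in two variables,
hence continuous on the diagonal. *)
Lemma difference_quotient p z0 : exists D : K * K -> K,
  (forall z z', p.[z] - p.[z'] = (z - z') * D (z, z')) /\
  D @ (z0, z0) --> p^`().[z0].
Proof.
elim/poly_ind: p => [|p c [D [DE cD]]].
  exists (cst 0); split; first by move=> z z'; rewrite !horner0 mulr0 subrr.
  by rewrite deriv0 horner0; exact: cvg_cst.
exists (fun zz => p.[zz.1] + zz.2 * D zz); split.
  move=> z z'; rewrite !hornerMXaddC /=.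
  transitivity ((z - z') * p.[z] + z' * (p.[z] - p.[z'])); first by ring.
  by rewrite DE; ring.
rewrite derivD derivM derivX derivC addr0 mulr1 hornerD hornerM hornerX addrC.
apply: cvgD; first exact: cvg_horner1.
by rewrite mulrC; apply: cvgM => //; exact: cvg_snd.
Qed.

(** The number [k] is the quotient of [p.[z] * q.[z'] - p.[z'] * q.[z]] by
[z - z'], whose limit on the diagonal is the Wronskian. The expression compared with
its limit [L] is the ratio of the squared difference of the values of [p / q] to the squared chordal
distance of the points. *)
Lemma stretch_limit p q z0 (e : K) : q.[z0] != 0 -> 0 < e ->
  let W := (p^`() * q - p * q^`()).[z0] in
  let L := `|W| ^+ 2 * (1 + `|z0| ^+ 2) * (1 + `|z0| ^+ 2) /
    (4 * `|q.[z0]| ^+ 2 * `|q.[z0]| ^+ 2) in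
  exists2 r : K, 0 < r & forall z z', `|z - z0| < r -> `|z' - z0| < r ->
    [/\ q.[z] != 0, q.[z'] != 0 & exists k, p.[z] * q.[z'] - p.[z'] * q.[z] = (z - z') * k /\
    `|L - `|k| ^+ 2 * (1 + `|z| ^+ 2) * (1 + `|z'| ^+ 2) /
      (4 * `|q.[z]| ^+ 2 * `|q.[z']| ^+ 2)| < e].
Proof.
move=> q0 e0 W L.
have [Dp [DpE cDp]] := difference_quotient p z0.
have [Dq [DqE cDq]] := difference_quotient q z0.
pose k (zz : K * K) := Dp zz * q.[zz.2] - p.[zz.2] * Dq zz.
have ck : k @ (z0, z0) --> W.
  rewrite /W hornerD hornerN !hornerM; apply: cvgB; apply: cvgM => //; exact: cvg_horner2.
have cN (f : K * K -> K) l : f @ (z0, z0) --> l ->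
    (fun zz => `|f zz| ^+ 2) @ (z0, z0) --> `|l| ^+ 2.
  move=> cf; rewrite expr2; under eq_fun do rewrite expr2.
  by apply: cvgM; apply: cvg_norm.
have cphi : (fun zz : K * K => `|k zz| ^+ 2 * (1 + `|zz.1| ^+ 2) * (1 + `|zz.2| ^+ 2) /
    (4 * `|q.[zz.1]| ^+ 2 * `|q.[zz.2]| ^+ 2)) @ (z0, z0) --> L.
  apply: cvgM.
    apply: cvgM; first apply: cvgM; first exact: cN.
      by apply: cvgD; [exact: cvg_cst|apply: cN; exact: cvg_fst].
    by apply: cvgD; [exact: cvg_cst|apply: cN; exact: cvg_snd].
  apply: cvgV.
    by rewrite !mulf_neq0 ?expf_neq0 ?normr_eq0 // pnatr_eq0.
  apply: cvgM; first apply: cvgM; first exact: cvg_cst.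
    by apply: cN; exact: cvg_horner1.
  by apply: cN; exact: cvg_horner2.
have FF : Filter (nbhs (z0, z0)) by exact: nbhs_filter.
have near1 := cvgr_neq0 _ (@cvg_horner1 q z0) q0.
have near2 := cvgr_neq0 _ (@cvg_horner2 q z0) q0.
have near3 := cvgr_dist_lt _ _ cphi e e0.
have [[A B] [/= nA nB] AB] := filterI (filterI (near1 FF) (near2 FF)) (near3 FF).
have /nbhs_ballP[r /= r0 rAB] : nbhs z0 (A `&` B) by exact: filterI.
exists r => // z z' zr z'r.
have Az : A z by apply: (rAB z _).1; rewrite /ball /= distrC.
have Bz : B z' by apply: (rAB z' _).2; rewrite /ball /= distrC.
have [[/= qz qz'] lim] := AB (z, z') (conj Az Bz).
split => //; exists (k (z, z')); split => //.
rewrite /k /=.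
transitivity ((p.[z] - p.[z']) * q.[z'] - p.[z'] * (q.[z] - q.[z'])); first by ring.
by rewrite DpE DqE; ring.
Qed.

End DifferenceQuotient.

(** * Infinitesimal stretch of the inverse branches *)

Section LocalStretch.
Local Open Scope complex_scope.
Context {R : realType}.
Local Notation C := R[i].
Implicit Types (p q : {poly C}) (x z : C).

Definition normsq z : R := complex.Re z ^+ 2 + complex.Im z ^+ 2.

Lemma normsqE z : `|z| ^+ 2 = (normsq z)%:C.
Proof. by rewrite -add_Re2_Im2. Qed.

Lemma normsq_ge0 z : 0 <= normsq z.
Proof. by rewrite addr_ge0 // sqr_ge0. Qed.

Lemma normsq_eq0 z : (normsq z == 0) = (z == 0).
Proof.
by rewrite -(inj_eq (@complexI R)) -normsqE /= expf_eq0 normr_eq0.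
Qed.

Lemma normsqM z w : normsq (z * w) = normsq z * normsq w.
Proof. by apply: (@complexI R); rewrite -normsqE normrM exprMn !normsqE rmorphM. Qed.

Lemma normsq_real (a : R) : normsq a%:C = a ^+ 2.
Proof. by rewrite /normsq /=; ring. Qed.

Lemma norm_real (a : R) : `|a%:C| = `|a|%:C :> C.
Proof. by rewrite normc_def /= expr0n addr0 sqrtr_sqr. Qed.

(** The spherical distance of two finite points. *)
Definition sdist z w : R := acos (dot3 (stereo3 z) (stereo3 w)).

Lemma stereo3_chord z w : 2 - 2 * dot3 (stereo3 z) (stereo3 w) =
  4 * normsq (z - w) / ((1 + normsq z) * (1 + normsq w)).
Proof.
case: z => x y; case: w => x' y'; rewrite /normsq /dot3 /=.
have := lt0r_neq0 (normsq_gt0 x y); have := lt0r_neq0 (normsq_gt0 x' y').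
move=> h h'; rewrite ![1 + (_ + _)]addrC; field; by rewrite h h'.
Qed.

Lemma stereo3_dot_itv z w : -1 <= dot3 (stereo3 z) (stereo3 w) <= 1.
Proof.
have h1 := stereo3_unit z; have h2 := stereo3_unit w.
case: (stereo3 z) h1 => a1 [a2 a3]; case: (stereo3 w) h2 => b1 [b2 b3]; rewrite /dot3 /= => h2 h1.
have := sqr_ge0 (a1 - b1); have := sqr_ge0 (a2 - b2); have := sqr_ge0 (a3 - b3).
have := sqr_ge0 (a1 + b1); have := sqr_ge0 (a2 + b2); have := sqr_ge0 (a3 + b3).
by move=> *; apply/andP; split; lra.
Qed.

Lemma stretch_factorE (k z z' a b : C) :
  (normsq k * (1 + normsq z) * (1 + normsq z') / (4 * normsq a * normsq b))%:C =
  `|k| ^+ 2 * (1 + `|z| ^+ 2) * (1 + `|z'| ^+ 2) / (4 * `|a| ^+ 2 * `|b| ^+ 2) :> C.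
Proof.
rewrite !normsqE; move: (normsq k) (normsq z) (normsq z') (normsq a) (normsq b).
move=> k2 z2 z2' a2 b2.
by rewrite rmorphM fmorphV !rmorphM rmorph_nat !rmorphD !rmorph1.
Qed.

(** Bookkeeping for [local_stretch]: [ch] is the squared chord, [a] the angle,
[s2] the squared difference of the values, and [phi] their ratio, close to [L]. *)
Lemma stretch_constants (eps e L phi ch a d s2 : R) :
  0 < eps -> 0 < e -> e <= 4^-1 -> e <= eps / 8 -> 0 < L ->
  `|L - phi| < e * L -> ch * phi = s2 -> 0 <= ch -> ch <= e ->
  ch = 2 - 2 * d -> a ^+ 2 * (1 + d) <= 2 * ch -> ch <= a ^+ 2 ->
  ((1 + e) * L)^-1 * s2 <= a ^+ 2 /\ a ^+ 2 <= (1 + eps) * (((1 + e) * L)^-1 * s2).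
Proof.
move=> eps0 e0 e4 e8 L0; rewrite ltr_norml => /andP[p1 p2] <- ch0 che chE h1 h2.
have phi0 : 0 < phi by nra.
have m0 : 0 < (1 + e) * L by rewrite mulr_gt0 // ltr_wpDl.
have h3 : a ^+ 2 <= (1 + e) * ch.
  have : a ^+ 2 * (1 - e / 4) <= ch by have := sqr_ge0 a; nra.
  move=> h4; have := sqr_ge0 a; nra.
split.
  rewrite mulrC ler_pdivrMr //; apply: le_trans (_ : ch * ((1 + e) * L) <= _).
    by rewrite ler_wpM2l //; lra.
  by rewrite ler_wpM2r // ltW.
apply: le_trans h3 _.
have -> : (1 + eps) * (((1 + e) * L)^-1 * (ch * phi)) =
    ch * ((1 + eps) * phi) / ((1 + e) * L) by set I := _^-1; ring.
rewrite ler_pdivlMr //.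
have -> : (1 + e) * ch * ((1 + e) * L) = ch * ((1 + e) ^+ 2 * L) by ring.
apply: ler_wpM2l => //; apply: le_trans (_ : (1 + eps) * ((1 - e) * L) <= _); last first.
  by rewrite ler_wpM2l //; lra.
rewrite mulrA ler_wpM2r //; first exact: ltW.
by nra.
Qed.

(** Where the Wronskian and [q] do not vanish, [p / q] is conformal, so that its
local inverse multiplies small distances by nearly constant factors. Squares of
distances are compared in order to avoid square roots. *)
Lemma local_stretch p q z0 (eps eta : R) : 0 < eps -> 0 < eta ->
  q.[z0] != 0 -> (p^`() * q - p * q^`()).[z0] != 0 ->
  exists r m : R, [/\ 0 < r, 0 < m & forall z z' (s t : R),
    `|z - z0| < r%:C -> `|z' - z0| < r%:C ->
    p.[z] = s%:C * q.[z] -> p.[z'] = t%:C * q.[z'] ->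
    [/\ m * (s - t) ^+ 2 <= sdist z z' ^+ 2,
        sdist z z' ^+ 2 <= (1 + eps) * (m * (s - t) ^+ 2) & sdist z z' <= eta]].
Proof.
move=> eps0 eta0 q0 W0; set W := _.[z0] in W0.
pose L := normsq W * (1 + normsq z0) * (1 + normsq z0) / (4 * normsq q.[z0] * normsq q.[z0]).
have pos z : 0 < 1 + normsq z by rewrite ltr_pwDl // normsq_ge0.
have nz z : z != 0 -> 0 < normsq z.
  by move=> z_neq0; rewrite lt_neqAle normsq_ge0 andbT eq_sym normsq_eq0.
have L0 : 0 < L by rewrite divr_gt0 ?mulr_gt0 // ?pos ?nz // pnatr_eq0.
(* The tolerance is such that [(1 + e) ^+ 2 <= (1 + eps) * (1 - e)]. *)
pose e := Num.min (4^-1) (eps / 8).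
have e0 : 0 < e by rewrite lt_min !divr_gt0 //= invr_gt0 ltr0n.
have [r1 r10 H] := @stretch_limit C p q z0 (e * L)%:C q0 (etrans (ltcR 0 (e * L)) (mulr_gt0 e0 L0)).
have r1E : r1 = (complex.Re r1)%:C by rewrite RRe_real // ger0_real // ltW.
pose dlt := Num.min e (eta ^+ 2 / 2).
have dlt0 : 0 < dlt by rewrite lt_min e0 divr_gt0 // exprn_gt0.
pose r2 := Num.sqrt (dlt / 16).
have r20 : 0 < r2 by rewrite sqrtr_gt0 divr_gt0.
have r22 : r2 ^+ 2 = dlt / 16 by rewrite sqr_sqrtr // divr_ge0 // ltW.
pose r := Num.min (complex.Re r1) r2.
have r0 : 0 < r by rewrite lt_min r20 andbT -ltcR -r1E.
exists r, (((1 + e) * L)^-1); split => //.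
  by rewrite invr_gt0 mulr_gt0 // ltr_pwDl // ltW.
move=> z z' s t zr z'r pz pz'.
have rr1 : r%:C <= r1 by rewrite r1E lecR ge_min lexx.
have rr2 : r <= r2 by rewrite ge_min lexx orbT.
have [qz qz' [k [kE kl]]] := H z z' (lt_le_trans zr rr1) (lt_le_trans z'r rr1).
set ch := 2 - 2 * dot3 (stereo3 z) (stereo3 z').
pose phi := normsq k * (1 + normsq z) * (1 + normsq z') / (4 * normsq q.[z] * normsq q.[z']).
have lim : `|L - phi| < e * L.
  rewrite -ltcR -norm_real rmorphB /= /L /phi !stretch_factorE.
  by have -> : (4 : C) = 4%:R by [].
have chE := stereo3_chord z z'; rewrite -/ch in chE.
have chphi : ch * phi = (s - t) ^+ 2.
  have : (s - t) ^+ 2 * (normsq q.[z] * normsq q.[z']) = normsq (z - z') * normsq k.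
    rewrite -normsq_real -!normsqM -kE pz pz' rmorphB; congr normsq; ring.
  rewrite chE /phi => E.
  have := nz _ qz; have := nz _ qz'; have := pos z; have := pos z'.
  move=> /lt0r_neq0 h1 /lt0r_neq0 h2 /lt0r_neq0 h3 /lt0r_neq0 h4.
  apply: (mulIf (mulf_neq0 h4 h3)); rewrite E; field.
  by rewrite h1 h2 h3 h4.
have dist_lt : ch <= dlt.
  have n1 : normsq (z - z') <= 4 * r2 ^+ 2.
    rewrite -lecR -normsqE rmorphM rmorphXn /= (_ : (4 : R)%:C = 2 ^+ 2); last first.
      by rewrite -natrX rmorph_nat.
    rewrite -exprMn lerXn2r ?nnegrE ?normr_ge0 //.
      by rewrite mulr_ge0 // ler0c ltW.
    rewrite -(subrKA z0) (le_trans (ler_normD _ _)) // mulr2n mulrDl mul1r lerD //.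
      by rewrite (le_trans (ltW zr)) // lecR.
    by rewrite distrC (le_trans (ltW z'r)) // lecR.
  rewrite chE ler_pdivrMr ?mulr_gt0 ?pos //.
  apply: le_trans (_ : dlt * 1 <= _); first by rewrite r22 in n1; lra.
  apply: ler_wpM2l; first exact: ltW.
  by rewrite mulr_ege1 // lerDl normsq_ge0.
have [c1 c2] := acos_chord (stereo3_dot_itv z z').
have ch0 : 0 <= ch.
  have /andP[_] := stereo3_dot_itv z z'; rewrite /ch; move: (dot3 _ _) => d'.
  by clear; lra.
have e4 : e <= 4^-1 by rewrite ge_min lexx.
have e8 : e <= eps / 8 by rewrite ge_min lexx orbT.
have che : ch <= e by apply: le_trans dist_lt _; rewrite ge_min lexx.
have [h1 h2] := stretch_constants eps0 e0 e4 e8 L0 lim chphi ch0 che erefl c1 c2.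
split => //.
have a0 : 0 <= sdist z z' by apply: acos_ge0; exact: stereo3_dot_itv.
rewrite -ler_sqr ?nnegrE //; last exact: ltW.
have dlt2 : dlt <= eta ^+ 2 / 2 by rewrite ge_min lexx orbT.
have dlt1 : dlt <= 1 by rewrite !ge_min invf_le1 ?ler1n ?ltr0n.
have ch1 : ch <= 1 := le_trans dist_lt dlt1.
apply: (@le_trans _ _ (2 * ch)); last first.
  by rewrite mulrC -ler_pdivlMr // (le_trans dist_lt).
rewrite /sdist; set a := acos _ in c1 c2 *.
have dE : 1 + dot3 (stereo3 z) (stereo3 z') = 2 - ch / 2 by rewrite /ch; field.
rewrite dE in c1; apply: le_trans c1; rewrite ler_peMr ?sqr_ge0 //.
by clear -ch1; lra.
Qed.

End LocalStretch.

(** * Inverse branches over short intervals *)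

Lemma common_radius (R : realDomainType) (T : finType) (P : T -> R -> Prop) :
  (forall t, exists2 r, 0 < r & forall r', 0 < r' <= r -> P t r') ->
  exists2 r, 0 < r & forall t, P t r.
Proof.
move=> Pr.
suff [r r0 Hr] : exists2 r, 0 < r & forall t, t \in enum T -> forall r', 0 < r' <= r -> P t r'.
  by exists r => // t; apply: (Hr t); rewrite ?mem_enum // r0 lexx.
elim: (enum T) => [|t s [r r0 IHs]]; first by exists 1.
have [r1 r10 H1] := Pr t; exists (Num.min r r1); first by rewrite lt_min r0.
move=> t'; rewrite inE => /orP[/eqP ->|/IHs {}IHs] r' /andP[r'0 r'm].
  by apply: H1; rewrite r'0 (le_trans r'm) // ge_min lexx orbT.
by apply: IHs; rewrite r'0 (le_trans r'm) // ge_min lexx.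
Qed.

Section Branches.
Local Open Scope complex_scope.
Context {R : realType}.
Local Notation C := R[i].
Variables (p q : {poly C}) (d : nat).
Hypothesis sp : (size p <= d.+1)%N.
Hypothesis d_gt0 : (0 < d)%N.
Hypothesis sq : (size q <= d.+1)%N.

Definition rnorm (z : C) : R := complex.Re `|z|.

Lemma rnormE z : `|z| = (rnorm z)%:C.
Proof. by rewrite /rnorm RRe_real // ger0_real. Qed.

Lemma rnorm_ge0 z : 0 <= rnorm z.
Proof. by rewrite -ler0c -rnormE. Qed.

Lemma rnorm_gt0 z : (0 < rnorm z) = (z != 0).
Proof. by rewrite -ltcR -rnormE normr_gt0. Qed.

Definition wronskian := p^`() * q - p * q^`().

Definition fiber (w : R) : {poly C} := p - w%:C *: q.

Lemma fiberE w x : (p.[x] == w%:C * q.[x]) = root (fiber w) x.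
Proof. by rewrite /root /fiber hornerD hornerN hornerZ subr_eq0. Qed.

(** It vanishes exactly when infinity belongs to the fibre. *)
Definition fiber_top (w : R) : C := p`_d - w%:C * q`_d.

Lemma fiber_lead w : fiber_top w != 0 ->
  size (fiber w) = d.+1 /\ lead_coef (fiber w) = fiber_top w.
Proof.
move=> l0; have c : (fiber w)`_d = fiber_top w by rewrite /fiber coefB coefZ.
have s : (size (fiber w) <= d.+1)%N.
  rewrite (leq_trans (size_polyD _ _)) // geq_max sp size_polyN.
  exact: leq_trans (size_scale_leq _ _) _.
have sE : size (fiber w) = d.+1.
  apply/eqP; rewrite eqn_leq s /=; rewrite ltnNge; apply/negP => sd.
  by move: l0; rewrite -c nth_default // eqxx.
by rewrite lead_coefE sE.
Qed.

(** All [d] points of the fibre are finite, simple and not poles. *)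
Definition good_value (w : R) := fiber_top w != 0 /\
  forall x, root (fiber w) x -> q.[x] != 0 /\ wronskian.[x] != 0.

(** The fibre over the values in [[u, v]] consists of [d] disjoint branches of
nearly constant speed, [m j] being about the square of the speed. *)
Definition good_branches (eps eta u v : R) (z : 'I_d -> R -> C) (m : 'I_d -> R) :=
  [/\ forall j, 0 < m j,
      forall j w, u <= w <= v -> root (fiber w) (z j w),
      forall j k w, u <= w <= v -> z j w = z k w -> j = k,
      forall w x, u <= w <= v -> root (fiber w) x -> exists j, x = z j w &
      forall j s t, u <= s <= v -> u <= t <= v ->
      [/\ m j * (s - t) ^+ 2 <= sdist (z j s) (z j t) ^+ 2,
          sdist (z j s) (z j t) ^+ 2 <= (1 + eps) * (m j * (s - t) ^+ 2) &
          sdist (z j s) (z j t) <= eta]].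

Definition good_interval (eps eta u v : R) :=
  exists z m, good_branches eps eta u v z m.

(** The value of the fibre polynomial of [w] at [z0] is small, and it is the
product of the leading coefficient and of the differences between [z0] and the
roots; one of these differences is therefore small. *)
Lemma root_nearby w0 z0 (r : R) : fiber_top w0 != 0 -> root (fiber w0) z0 -> 0 < r ->
  exists2 rho : R, 0 < rho & forall w, `|w - w0| < rho ->
    fiber_top w != 0 /\ exists2 x, root (fiber w) x & `|x - z0| < r%:C.
Proof.
move=> l0 z0r r0; pose L := rnorm (fiber_top w0).
have L0 : 0 < L by rewrite rnorm_gt0.
pose A := rnorm q.[z0]; pose Q := rnorm q`_d.
have A0 : 0 <= A := rnorm_ge0 _; have Q0 : 0 <= Q := rnorm_ge0 _.
(* The second bound keeps the leading coefficient above [L / 2]; the first then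
   contradicts that all roots are at distance at least [r]. *)
pose rho := Num.min (L / 2 * r ^+ d / (A + 1)) (L / 2 / (Q + 1)).
have rho0 : 0 < rho.
  have A1 : 0 < A + 1 by rewrite ltr_wpDl.
  have Q1 : 0 < Q + 1 by rewrite ltr_wpDl.
  by rewrite lt_min !divr_gt0 // mulr_gt0 ?exprn_gt0 // divr_gt0.
exists rho => // w wr.
have h1 : `|w - w0| * A < L / 2 * r ^+ d.
  have : `|w - w0| < L / 2 * r ^+ d / (A + 1) by rewrite (lt_le_trans wr) // ge_min lexx.
  rewrite ltr_pdivlMr ?ltr_wpDl // => h; apply: le_lt_trans h.
  by rewrite ler_wpM2l // lerDl.
have h2 : `|w - w0| * Q < L / 2.
  have : `|w - w0| < L / 2 / (Q + 1) by rewrite (lt_le_trans wr) // ge_min lexx orbT.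
  rewrite ltr_pdivlMr ?ltr_wpDl // => h; apply: le_lt_trans h.
  by rewrite ler_wpM2l // lerDl.
have h3 : L / 2 < rnorm (fiber_top w).
  rewrite -ltcR -rnormE.
  have -> : fiber_top w = fiber_top w0 - (w - w0)%:C * q`_d.
    by rewrite /fiber_top rmorphB /=; ring.
  apply: lt_le_trans (lerB_dist _ _); rewrite normrM norm_real !rnormE -rmorphM -rmorphB ltcR.
  by rewrite -/L -/Q; lra.
have lw0 : fiber_top w != 0 by rewrite -rnorm_gt0 (lt_trans _ h3) // divr_gt0.
split => //; have [sg lg] := fiber_lead lw0.
have [rs rsE] := closed_field_poly_normal (fiber w).
apply: contrapT => noroot.
have far x : x \in rs -> r%:C <= `|z0 - x|.
  move=> xrs; rewrite real_leNgt ?normr_real //; last by rewrite complex_real.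
  apply/negP => xr; apply: noroot; exists x; last by rewrite distrC.
  rewrite rsE lg rootZ // root_prod_XsubC //.
have ev : `|(fiber w).[z0]| = (`|w - w0| * A)%:C.
  rewrite rmorphM /= -norm_real -rnormE -normrM -normrN; congr `|_|.
  move/eqP: z0r; rewrite /fiber !hornerD !hornerN !hornerZ => /eqP.
  by rewrite subr_eq0 => /eqP ->; rewrite rmorphB; ring.
have srs : size rs = d.
  move: sg; rewrite rsE lg size_scale // size_prod_XsubC => -[].
  by [].
have : (L / 2 * r ^+ d)%:C <= `|(fiber w).[z0]|.
  rewrite rsE lg hornerZ horner_prod normrM normr_prod rmorphM /=.
  apply: ler_pM; rewrite ?ler0c ?exprn_ge0 ?divr_ge0 ?(ltW L0) ?(ltW r0) //.
    by rewrite rnormE lecR ltW.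
  rewrite rmorphXn /= -srs; elim: (rs) far => [|x s IHs] far; first by rewrite big_nil expr0.
  rewrite big_cons exprS ler_pM ?exprn_ge0 ?ler0c ?(ltW r0) //.
    by rewrite hornerXsubC far // mem_head.
  by apply: IHs => y ys; rewrite far // inE ys orbT.
by rewrite ev lecR leNgt h1.
Qed.

(** Disjoint discs around the [d] simple roots over [w0] each contain a root over
any nearby value, and there is no room for other roots. On the discs
[local_stretch] applies. *)
Lemma good_value_interval w0 (eps eta : R) : 0 < eps -> 0 < eta -> good_value w0 ->
  exists2 rho, 0 < rho & forall u v, w0 - rho < u -> v < w0 + rho -> good_interval eps eta u v.
Proof.
move=> eps0 eta0 [l0 good].
have [sg lg] := fiber_lead l0.
have [rs rsE] := closed_field_poly_normal (fiber w0).
have srs : size rs = d.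
  by move: sg; rewrite rsE lg size_scale // size_prod_XsubC => -[].
have rsroot x : (x \in rs) = root (fiber w0) x.
  by rewrite rsE lg rootZ // root_prod_XsubC.
(* A double root would be a zero of the Wronskian. *)
have urs : uniq rs.
  rewrite -separable_prod_XsubC unlock; apply/Pdiv.ClosedField.coprimepP => x xr.
  have := xr; rewrite root_prod_XsubC rsroot => xw; have [q0] := good x xw.
  apply: contraNN => dx0.
  have : (fiber w0)^`().[x] = 0.
    by rewrite rsE derivZ hornerZ (eqP dx0) mulr0.
  rewrite /fiber derivB derivZ hornerD hornerN hornerZ => /eqP; rewrite subr_eq0 => /eqP e1.
  move/eqP: xw; rewrite /fiber hornerD hornerN hornerZ => /eqP; rewrite subr_eq0 => /eqP e2.
  by rewrite /wronskian hornerD hornerN !hornerM e1 e2; apply/eqP; ring.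
pose z0 (j : 'I_d) := rs`_j.
have z0r j : root (fiber w0) (z0 j) by rewrite -rsroot mem_nth // srs.
have z0inj j k : j != k -> z0 j != z0 k.
  by rewrite /z0 nth_uniq // srs.
have /choice[rm Hrm] : forall j, exists rm : R * R,
    [/\ 0 < rm.1, 0 < rm.2 & forall z z' (s t : R),
    `|z - z0 j| < rm.1%:C -> `|z' - z0 j| < rm.1%:C ->
    p.[z] = s%:C * q.[z] -> p.[z'] = t%:C * q.[z'] ->
    [/\ rm.2 * (s - t) ^+ 2 <= sdist z z' ^+ 2,
        sdist z z' ^+ 2 <= (1 + eps) * (rm.2 * (s - t) ^+ 2) & sdist z z' <= eta]].
  move=> j; have [q0 W0] := good _ (z0r j).
  by have [r [m H]] := local_stretch eps0 eta0 q0 W0; exists (r, m).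
have [r r0 Hr] : exists2 r : R, 0 < r & forall jk : 'I_d * 'I_d,
    r <= (rm jk.1).1 /\ (jk.1 != jk.2 -> (r + r)%:C <= `|z0 jk.1 - z0 jk.2|).
  apply: common_radius => -[j k] /=; have [rj _ _] := Hrm j.
  have [<-|jk] := eqVneq j k.
    by exists (rm j).1 => // r' /andP[_ ->]; split.
  pose D := rnorm (z0 j - z0 k).
  have D0 : 0 < D by rewrite rnorm_gt0 subr_eq0 z0inj.
  exists (Num.min (rm j).1 (D / 2)); first by rewrite lt_min rj divr_gt0.
  move=> r' /andP[_]; rewrite le_min => /andP[r1 r2]; split => // _.
  by rewrite rnormE lecR -/D; lra.
have [rho rho0 Hrho] : exists2 rho : R, 0 < rho & forall j, forall w, `|w - w0| < rho ->
    fiber_top w != 0 /\ exists2 x, root (fiber w) x & `|x - z0 j| < r%:C.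
  apply: common_radius => j; have [rho rho0 H] := root_nearby l0 (z0r j) r0.
  by exists rho => // rho' /andP[_ le] w wr; apply: H; exact: lt_le_trans le.
exists (Num.min rho 1).
  by rewrite lt_min rho0 ltr01.
move=> u v uw vw.
have near w : u <= w <= v -> `|w - w0| < rho.
  move=> /andP[uw' wv']; rewrite ltr_distl.
  have : Num.min rho 1 <= rho by rewrite ge_min lexx.
  by move=> h; apply/andP; split; lra.
have /choice[z Hz] : forall jw : 'I_d * R, exists x, `|jw.2 - w0| < rho ->
    root (fiber jw.2) x /\ `|x - z0 jw.1| < r%:C.
  move=> [j w] /=; have [wr|wr] := pselect (`|w - w0| < rho); last by exists 0.
  by have [_ [x]] := Hrho j w wr; exists x.
have zinj j k w : u <= w <= v -> z (j, w) = z (k, w) -> j = k.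
  move=> uwv zz; apply/eqP/negPn/negP => jk.
  have [_ h1] := Hz (j, w) (near w uwv); have [_ h2] := Hz (k, w) (near w uwv).
  have [_ /(_ jk) /=] := Hr (j, k).
  rewrite /= -zz in h1 h2; rewrite real_leNgt ?normr_real ?complex_real // => /negP; apply.
  rewrite -(subrKA (z (j, w))) (le_lt_trans (ler_normD _ _)) // rmorphD /=.
  by rewrite ltrD // distrC.
exists (fun j w => z (j, w)), (fun j => (rm j).2); split => //.
- by move=> j; have [] := Hrm j.
- by move=> j w /near uwv; have [] := Hz (j, w) uwv.
- move=> w x uwv xr; apply: contrapT => /forallNP xz.
  have [lw _] := Hrho (Ordinal d_gt0) w (near w uwv).
  have [sgw _] := fiber_lead lw.
  have g0 : fiber w != 0 by rewrite -size_poly_gt0 sgw.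
  pose xs := x :: [seq z (j, w) | j <- enum 'I_d].
  have h1 : all (root (fiber w)) xs.
    rewrite /= xr; apply/allP => _ /mapP[j _ ->].
    by have [] := Hz (j, w) (near w uwv).
  have h2 : uniq xs.
    apply/andP; split; first by apply/mapP => -[j _]; exact: xz.
    by rewrite -/(uniq _) map_inj_uniq ?enum_uniq // => j k; exact: zinj.
  by have := max_poly_roots g0 h1 h2; rewrite /= size_map size_enum_ord sgw ltnn.
- move=> j s t us ut; have [_ _ H] := Hrm j.
  have [/= rs1 rs2] := Hz (j, s) (near s us).
  have [/= rt1 rt2] := Hz (j, t) (near t ut).
  have [rrj _] := Hr (j, j).
  have rr : r%:C <= (rm j).1%:C by rewrite lecR.
  have e1 : p.[z (j, s)] = s%:C * q.[z (j, s)] by apply/eqP; rewrite fiberE.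
  have e2 : p.[z (j, t)] = t%:C * q.[z (j, t)] by apply/eqP; rewrite fiberE.
  exact: H (lt_le_trans rs2 rr) (lt_le_trans rt2 rr) e1 e2.
Qed.

End Branches.

(** * Crofton bound for disjoint arcs of the preimage *)

Section Arcs.
Local Open Scope complex_scope.
Context {R : realType}.
Local Notation C := R[i].
Implicit Types (x : C) (n : R * (R * R)).

(** The function is extended to the line by composition with the retraction onto
[[u, v]]. *)
Lemma lipschitz_ivt (f : R -> R) (u v M : R) : u <= v -> 0 <= M ->
  (forall s t, u <= s <= v -> u <= t <= v -> (f s - f t) ^+ 2 <= M * (s - t) ^+ 2) ->
  f u * f v < 0 -> exists2 w, u < w < v & f w = 0.
Proof.
move=> uv M0 fM fuv.
pose c w := Num.max u (Num.min v w).
have cI w : u <= c w <= v by rewrite /c le_max lexx ge_max uv ge_min lexx.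
have cid w : u <= w <= v -> c w = w.
  by move=> /andP[uw wv]; rewrite /c (min_idPr wv) (max_idPr uw).
have cc w w' : (c w - c w') ^+ 2 <= (w - w') ^+ 2.
  have mx a b : (Num.max u a - Num.max u b) ^+ 2 <= (a - b) ^+ 2.
    rewrite /Order.max; case: ltP => h1; case: ltP => h2;
      rewrite -subr_ge0 ?subrr ?expr0n /= ?subr0 ?sqr_ge0 //; nra.
  have mn a b : (Num.min v a - Num.min v b) ^+ 2 <= (a - b) ^+ 2.
    rewrite /Order.min; case: ltP => h1; case: ltP => h2;
      rewrite -subr_ge0 ?subrr ?expr0n /= ?subr0 ?sqr_ge0 //; nra.
  exact: le_trans (mx _ _) (mn _ _).
pose g w := f (c w).
have cg : continuous g.
  move=> w; apply/cvgrPdist_lt => e e0; near=> w'.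
  have h : (g w - g w') ^+ 2 <= M * (w - w') ^+ 2.
    by apply: le_trans (fM _ _ (cI w) (cI w')) _; rewrite ler_wpM2l.
  have h2 : `|w - w'| < e / (M + 1).
    by near: w'; apply: cvgr_dist_lt => //; rewrite divr_gt0 // ltr_wpDl.
  rewrite -ltr_sqr ?nnegrE ?normr_ge0 ?ltW // real_normK ?num_real //.
  apply: le_lt_trans h _.
  have h3 : (w - w') ^+ 2 < (e / (M + 1)) ^+ 2.
    by rewrite -[ltLHS]real_normK ?num_real // ltr_sqr ?nnegrE ?normr_ge0 // divr_ge0 // ltW // ltr_wpDl.
  apply: le_lt_trans (_ : M * (e / (M + 1)) ^+ 2 < _).
    by rewrite ler_wpM2l // ltW.
  rewrite expr_div_n mulrA ltr_pdivrMr ?exprn_gt0 ?ltr_wpDl //.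
  by rewrite mulrC ltr_pM2l ?exprn_gt0 //; nra.
have [|w] := @IVT R g u v 0 uv (continuous_subspaceT cg).
  rewrite /g !cid ?lexx ?uv // ge_min le_max.
  have [fu|fu] := lerP (f u) 0; have [fv|fv] := lerP (f v) 0;
    rewrite ?orbT //= ?(ltW fu) ?(ltW fv) ?orbT //=; exfalso; nra.
rewrite in_itv /= => uwv; rewrite /g (cid _ uwv) => fw; exists w => //.
have /andP[uw wv] := uwv; rewrite !lt_neqAle uw wv !andbT.
apply/andP; split; apply/eqP => e.
  by rewrite e fw mul0r ltxx in fuv.
by rewrite -e fw mulr0 ltxx in fuv.
Unshelve. all: by end_near.
Qed.

Lemma dot3_lipschitz n (x y : C) :
  (dot3 n (stereo3 x) - dot3 n (stereo3 y)) ^+ 2 <= dot3 n n * sdist x y ^+ 2.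
Proof.
have [_ h] := acos_chord (stereo3_dot_itv x y).
have n0 : 0 <= dot3 n n by rewrite /dot3 !addr_ge0 // -expr2 sqr_ge0.
apply: le_trans (ler_wpM2l n0 h).
have := stereo3_unit x; have := stereo3_unit y.
case: (stereo3 x) => a1 [a2 a3]; case: (stereo3 y) => b1 [b2 b3]; case: n {n0 h} => n1 [n2 n3].
rewrite /dot3 /= => hb ha.
have := sqr_ge0 (n1 * (a2 - b2) - n2 * (a1 - b1)).
have := sqr_ge0 (n1 * (a3 - b3) - n3 * (a1 - b1)).
have := sqr_ge0 (n2 * (a3 - b3) - n3 * (a2 - b2)).
have -> : 2 - 2 * (a1 * b1 + (a2 * b2 + a3 * b3)) =
    (a1 - b1) ^+ 2 + ((a2 - b2) ^+ 2 + (a3 - b3) ^+ 2).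
  by rewrite -[2]/(1 + 1) -{1}ha -{1}hb; ring.
by move=> *; lra.
Qed.

Variables (p q : {poly C}) (d : nat).
Hypothesis pq : coprimep p q.
Hypothesis sp : (size p <= d.+1)%N.
Hypothesis sq : (size q <= d.+1)%N.

Lemma conjc_realM (t : R) (z : C) : conjc (t%:C * z) = t%:C * conjc z.
Proof. by case: z => x y; rewrite /real_complex_def; simpc; congr (_ +i* _); ring. Qed.

Lemma fiber_q_neq0 w x : root (fiber p q w) x -> q.[x] != 0.
Proof.
rewrite -fiberE => /eqP px; apply/negP => q0.
by have := coprimep_root pq (x := x); rewrite /root px (eqP q0) mulr0 eqxx => /(_ isT).
Qed.

Lemma fiber_real_ratio w x : root (fiber p q w) x -> real_ratio p q x.
Proof.
rewrite -fiberE => /eqP px; rewrite /real_ratio px conjc_realM.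
by apply/eqP; ring.
Qed.

(** Arcs over disjoint sets of values are disjoint. *)
Lemma fiber_inj w w' x : root (fiber p q w) x -> root (fiber p q w') x -> w = w'.
Proof.
move=> r1 r2; have q0 := fiber_q_neq0 r1.
move: r1 r2; rewrite -!fiberE => /eqP -> /eqP /(mulIf q0); exact: complexI.
Qed.

(** A great circle that separates the end points of an arc meets its interior.
Since the arcs are disjoint, the intersection points are distinct, and there are at
most [d + d] of them on a generic great circle. *)
Lemma arcs_length_le (x : C) (I : eqType) (s : seq I) (u v : I -> R)
    (z : I -> R -> C) (M : I -> R) (eta : R) :
  ~~ real_ratio p q x -> 0 <= eta < pi -> uniq s ->
  (forall i, i \in s -> [/\ u i <= v i, 0 <= M i, sdist (z i (u i)) (z i (v i)) <= eta,
     forall w, u i <= w <= v i -> root (fiber p q w) (z i w) &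
     forall a b, u i <= a <= v i -> u i <= b <= v i ->
       sdist (z i a) (z i b) ^+ 2 <= M i * (a - b) ^+ 2]) ->
  (forall i j w, i \in s -> j \in s -> u i < w < v i -> u j < w < v j ->
     z i w = z j w -> i = j) ->
  \sum_(i <- s) sdist (z i (u i)) (z i (v i)) <= (d + d)%:R * (pi + eta).
Proof.
move=> xr eta_itv us sP sI.
have [l [l0 lP]] := generic_great_circle sp sq xr.
pose ab i := (stereo3 (z i (u i)), stereo3 (z i (v i))).
have := @crofton_bound R [seq ab i | i <- s] l (d + d) eta eta_itv _ _ _.
rewrite big_map; apply.
- move=> _ /mapP[i /sP[_ _ le _ _] ->]; split => //.
  - exact: stereo3_unit.
  - exact: stereo3_unit.
  - exact: stereo3_dot_itv.
- exact: l0.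
move=> n /lP[n0 [z0 nz0 z0r]]; rewrite count_map -size_filter.
pose s' : seq I := [seq i <- s | dot3 n (ab i).1 * dot3 n (ab i).2 < 0].
change (size s' <= d + d)%N.
have s'P i : i \in s' -> exists w, u i < w < v i /\ dot3 n (stereo3 (z i w)) = 0.
  rewrite mem_filter => /andP[/= neg /sP[uv M0 _ _ lip]].
  have [||w uwv nw] := @lipschitz_ivt (fun w => dot3 n (stereo3 (z i w))) _ _ (dot3 n n * M i) uv _ _ neg.
  - by rewrite mulr_ge0 // /dot3 !addr_ge0 // -expr2 sqr_ge0.
  - move=> a b ha hb; apply: le_trans (dot3_lipschitz _ _ _) _; rewrite -mulrA.
    by apply: ler_wpM2l; [rewrite /dot3 !addr_ge0 // -expr2 sqr_ge0|exact: lip].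
  by exists w.
have /choice[w Hw] : forall i, exists w, i \in s' ->
    u i < w < v i /\ dot3 n (stereo3 (z i w)) = 0.
  move=> i; have [is'|] := boolP (i \in s'); last by exists 0.
  by have [w] := s'P i is'; exists w.
have s's i : i \in s' -> i \in s by rewrite mem_filter => /andP[].
have wr i : i \in s' -> root (fiber p q (w i)) (z i (w i)).
  move=> is'; have [_ _ _ zr _] := sP i (s's i is').
  by have [/andP[uw wv] _] := Hw i is'; apply: zr; rewrite !ltW.
rewrite -(size_map (fun i => z i (w i))).
apply: (great_circle_count sp sq n0 nz0 z0r).
  rewrite map_inj_in_uniq ?filter_uniq // => i j is' js' zz.
  have ww : w i = w j by apply: fiber_inj (wr i is') _; rewrite zz; exact: wr.
  apply: (sI i j (w i)); rewrite ?s's //; [exact: (Hw i is').1|rewrite ww; exact: (Hw j js').1|].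
  by rewrite zz ww.
move=> _ /mapP[i is' ->]; split; first exact: fiber_real_ratio (wr i is').
exact: (Hw i is').2.
Qed.

End Arcs.

(** * Hausdorff measure and dyadic intervals *)

Section HausdorffUpperBound.
Context {R : realType} {T : Type} (dist : T -> T -> R).

Lemma diam_le (A : set T) (r : R) : 0 <= r ->
  (forall x y, A x -> A y -> dist x y <= r) -> (diam dist A <= r%:E)%E.
Proof.
move=> r0 Ar; apply: ge_ereal_sup => _ [->|[[x y] [/= Ax Ay] <-]]; first by rewrite lee_fin.
by rewrite lee_fin Ar.
Qed.

Lemma diam_ge0 (A : set T) : (0 <= diam dist A)%E.
Proof. by apply: ereal_sup_ubound; left. Qed.

(** Covers indexed by any countable type can be used, and their total size can be
checked on finite subfamilies. *)
Lemma hausdorff1_delta_le (I : countType) (B : I -> set T) (len : I -> R)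
    (delta K : R) (A : set T) : 0 <= delta ->
  (forall x, A x -> exists i, B i x) ->
  (forall i, (diam dist (B i) <= (len i)%:E)%E) ->
  (forall i, (diam dist (B i) <= delta%:E)%E) ->
  (forall s, uniq s -> \sum_(i <- s) len i <= K) ->
  (hausdorff1_delta dist delta A <= K%:E)%E.
Proof.
move=> delta0 AB Blen Bdelta lenK.
pose Bk k := oapp B set0 (@pickle_inv I k).
have diam0 r : 0 <= r -> (diam dist set0 <= r%:E)%E by move=> r0; apply: diam_le.
apply: (@le_trans _ _ (\sum_(0 <= k <oo) diam dist (Bk k))%E).
  apply: ereal_inf_lbound; exists Bk => //; split.
    move=> x /AB[i Bi]; exists (pickle i) => //.
    by rewrite /Bk pickleK_inv.
  by move=> k; rewrite /Bk; case: pickle_inv => [i|] /=; [exact: Bdelta|exact: diam0].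
apply: lime_le; first by apply: is_cvg_nneseries => n _ _; exact: diam_ge0.
apply: nearW => N.
pose s := pmap (@pickle_inv I) (index_iota 0 N).
have us : uniq s.
  by apply: (@pmap_uniq _ _ (@pickle_inv I) pickle); [exact: pickle_invK|exact: iota_uniq].
apply: (@le_trans _ _ (\sum_(i <- s) len i)%:E); last by rewrite lee_fin lenK.
rewrite /s -sumEFin; elim: (index_iota 0 N) => [|k r IHr]; first by rewrite !big_nil.
rewrite big_cons /=; case E : (@pickle_inv I k) => [i|] /=.
  by rewrite big_cons leeD // /Bk E /=.
rewrite -[leRHS]add0e; apply: leeD => //.
by rewrite /Bk E /=; exact: diam0.
Qed.

End HausdorffUpperBound.

Section Dyadic.
Context {R : realType}.

Definition dyadic_left (n : nat) (k : int) : R := k%:~R / 2 ^+ n.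
Definition dyadic_right (n : nat) (k : int) : R := (k + 1)%:~R / 2 ^+ n.

Definition dyadic_index (n : nat) (w : R) : int := Num.floor (w * 2 ^+ n).

Lemma exp2_gt0 (n : nat) : 0 < 2 ^+ n :> R.
Proof. by rewrite exprn_gt0. Qed.

Lemma dyadic_indexP n w k : dyadic_index n w = k <-> dyadic_left n k <= w < dyadic_right n k.
Proof.
rewrite /dyadic_left /dyadic_right ler_pdivrMr ?ltr_pdivlMr ?exp2_gt0 //.
split; first by move<-; exact: floor_itv.
exact: floor_def.
Qed.

(** The dyadic interval of generation [n] around [w] contains the one of any later
generation. *)
Lemma dyadic_index_ancestor n n' w : (n <= n')%N ->
  dyadic_index n (dyadic_left n' (dyadic_index n' w)) = dyadic_index n w.
Proof.
move=> nn'; set k := dyadic_index n' w; set m := dyadic_index n w.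
have /andP[k1 k2] : dyadic_left n' k <= w < dyadic_right n' k by apply/dyadic_indexP.
have /andP[m1 m2] : dyadic_left n m <= w < dyadic_right n m by apply/dyadic_indexP.
apply/dyadic_indexP; rewrite (le_lt_trans k1 m2) andbT.
have e : 2 ^+ n' = 2 ^+ n * 2 ^+ (n' - n) :> R by rewrite -exprD subnKC.
have p0 := exp2_gt0 n; have p1 := exp2_gt0 (n' - n); have p2 := exp2_gt0 n'.
have h : (m * 2 ^+ (n' - n))%:~R < (k + 1)%:~R :> R.
  have := le_lt_trans m1 k2; rewrite /dyadic_left /dyadic_right e invfM mulrA mulrAC.
  by rewrite ltr_pM2r ?invr_gt0 // ltr_pdivlMr // rmorphM rmorphXn.
rewrite ltr_int ltzD1 in h.
rewrite /dyadic_left e invfM mulrA mulrAC ler_pM2r ?invr_gt0 // ler_pdivlMr //.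
by rewrite -(ler_int R) rmorphM rmorphXn in h.
Qed.

Variable G : nat -> int -> Prop.

(** Dyadic intervals are nested or disjoint, so that the maximal ones with property
[G] are disjoint. *)
Definition maximal_dyadic (nk : nat * int) := G nk.1 nk.2 /\
  forall n', (n' < nk.1)%N -> ~ G n' (dyadic_index n' (dyadic_left nk.1 nk.2)).

Lemma maximal_dyadic_cover n w : G n (dyadic_index n w) ->
  exists nk, maximal_dyadic nk /\ dyadic_left nk.1 nk.2 <= w < dyadic_right nk.1 nk.2.
Proof.
move=> Gn; have exG : exists n, `[< G n (dyadic_index n w) >] by exists n; apply/asboolP.
have := ex_minnP exG => -[m /asboolP Gm mmin].
exists (m, dyadic_index m w); split; last by apply/dyadic_indexP.
split => //= n' n'm; rewrite (dyadic_index_ancestor _ (ltnW n'm)) => Gn'.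
by have := mmin n' (asboolT Gn'); rewrite leqNgt n'm.
Qed.

Lemma maximal_dyadic_disjoint nk nk' w : maximal_dyadic nk -> maximal_dyadic nk' ->
  dyadic_left nk.1 nk.2 <= w < dyadic_right nk.1 nk.2 ->
  dyadic_left nk'.1 nk'.2 <= w < dyadic_right nk'.1 nk'.2 -> nk = nk'.
Proof.
wlog le : nk nk' / (nk.1 <= nk'.1)%N.
  move=> H h1 h2 h3 h4; have [le|/ltnW le] := leqP nk.1 nk'.1; first exact: H.
  by apply/esym; exact: H.
case: nk nk' le => [n k] [n' k'] /= le [Gk _] [_ Gk'] /dyadic_indexP kE /dyadic_indexP kE'.
move: le; rewrite leq_eqVlt => /orP[/eqP nn|lt].
  by subst n'; rewrite -kE -kE'.
by case: (Gk' n lt); rewrite /= -kE' (dyadic_index_ancestor _ (ltnW lt)) kE.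
Qed.

End Dyadic.

(** * Length of the preimage of the real line *)

Section RealPreimage.
Local Open Scope complex_scope.
Context {R : realType}.
Local Notation C := R[i].
Implicit Types (z : C) (p q : {poly C}).

Lemma spherical_dist_refl (x : sphere R) : spherical_dist x x = 0.
Proof.
case: x => [z|]; first by rewrite spherical_distE stereo3_unit acos1.
by rewrite /spherical_dist !big_ord_recl big_ord0 /= !mxE /= !mulr0 !add0r mulr1 addr0 acos1.
Qed.

Variables (p q : {poly C}) (d : nat).
Hypothesis pq : coprimep p q.
Hypothesis sp : (size p <= d.+1)%N.
Hypothesis sq : (size q <= d.+1)%N.
Hypothesis d_gt0 : (0 < d)%N.
Variables (x0 : C) (bad : seq C).
Hypothesis x0_nonreal : ~~ real_ratio p q x0.
Hypothesis badP : forall z, real_ratio p q z -> z \notin bad ->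
  exists2 w, good_value p q d w & root (fiber p q w) z.

(** The cover consists of the branches over the maximal dyadic intervals that carry
such branches, and of finitely many single points. *)
Lemma real_preimage_delta (delta eps eta : R) (E : set (sphere R)) :
  (forall z, E (Some z) -> real_ratio p q z) ->
  0 < eps -> 0 < eta -> eta < pi -> eta <= delta ->
  (hausdorff1_delta spherical_dist delta E <= ((1 + eps) * ((d + d)%:R * (pi + eta)))%:E)%E.
Proof.
move=> ER eps0 eta0 eta_pi eta_delta.
pose G n k := good_interval p q d eps eta (dyadic_left n k) (dyadic_right n k).
have /choice[Zm HZ] : forall nk : nat * int,
    exists zm : ('I_d -> R -> C) * ('I_d -> R), G nk.1 nk.2 ->
    good_branches p q eps eta (dyadic_left nk.1 nk.2) (dyadic_right nk.1 nk.2) zm.1 zm.2.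
  move=> nk; have [[z [m H]]|nG] := pselect (G nk.1 nk.2); first by exists (z, m).
  by exists (fun _ _ => 0, fun=> 0).
pose Z (x : nat * int * 'I_d) := (Zm x.1).1 x.2.
pose u (x : nat * int * 'I_d) : R := dyadic_left x.1.1 x.1.2.
pose v (x : nat * int * 'I_d) : R := dyadic_right x.1.1 x.1.2.
have uv x : u x < v x.
  by rewrite /u /v /dyadic_left /dyadic_right ltr_pM2r ?invr_gt0 ?exp2_gt0 // ltr_int ltzD1.
pose sel (x : nat * int * 'I_d) := maximal_dyadic (R := R) G x.1.
pose pts : seq (sphere R) := None :: [seq Some z | z <- bad].
pose B (t : nat * int * 'I_d + nat) : set (sphere R) := match t with
  | inl x => if `[< sel x >]
      then [set Some (Z x w) | w in [set w | u x <= w < v x]] else set0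
  | inr i => [set nth None pts i] end.
pose len (t : nat * int * 'I_d + nat) : R := match t with
  | inl x => if `[< sel x >] then (1 + eps) * sdist (Z x (u x)) (Z x (v x)) else 0
  | inr i => 0 end.
have sdist_ge0 y z : 0 <= sdist y z by apply: acos_ge0; exact: stereo3_dot_itv.
have arc x w w' : sel x -> u x <= w <= v x -> u x <= w' <= v x ->
    sdist (Z x w) (Z x w') <= (1 + eps) * sdist (Z x (u x)) (Z x (v x)) /\
    sdist (Z x w) (Z x w') <= eta.
  move=> [/HZ[m0 _ _ _ H] _] hw hw'.
  have [_ h1 h2] := H x.2 w w' hw hw'; split => //.
  have [||h3 _ _] := H x.2 (u x) (v x); rewrite ?lexx ?(ltW (uv x)) //.
  have e1 : 0 <= 1 + eps by rewrite addr_ge0 // ltW.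
  rewrite -ler_sqr ?nnegrE ?mulr_ge0 //; apply: le_trans h1 _.
  rewrite exprMn expr2 -mulrA; apply: ler_wpM2l => //.
  apply: le_trans (_ : (Zm x.1).2 x.2 * (u x - v x) ^+ 2 <= _).
    apply: ler_wpM2l; first exact: ltW.
    move: hw hw' => /andP[? ?] /andP[? ?]; nra.
  apply: le_trans h3 _; rewrite -[leLHS]mul1r ler_wpM2r ?sqr_ge0 // lerDl ltW //.
apply: (hausdorff1_delta_le (B := B) (len := len)).
- by rewrite (le_trans _ eta_delta) // ltW.
- move=> [z|] Ez; last by exists (inr 0%N).
  have [zbad|zbad] := boolP (z \in bad).
    exists (inr (index z bad).+1) => /=.
    by rewrite (nth_map 0) ?index_mem // nth_index.
  have [w gw zw] := badP (ER z Ez) zbad.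
  have [rho rho0 Hrho] := good_value_interval sp d_gt0 sq eps0 eta0 gw.
  have [n n_rho] : exists n : nat, (2 ^+ n)^-1 < rho.
    exists (Num.truncn rho^-1).+1.
    rewrite invf_plt ?posrE ?exp2_gt0 //; apply: lt_le_trans (truncnS_gt _) _.
    by rewrite -natrX ler_nat ltnW // ltn_expl.
  have gG : G n (dyadic_index n w).
    have /andP[w1 w2] := (dyadic_indexP n w _).1 erefl.
    have e : dyadic_right n (dyadic_index n w) =
        dyadic_left n (dyadic_index n w) + (2 ^+ n)^-1 :> R.
      by rewrite /dyadic_right /dyadic_left intrD mulrDl mul1r.
    by apply: Hrho; lra.
  have [nk [nkmax wnk]] := maximal_dyadic_cover gG.
  have [_ _ _ ze _] := HZ nk nkmax.1.
  have wnk' : dyadic_left nk.1 nk.2 <= w <= dyadic_right nk.1 nk.2.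
    by have /andP[-> /ltW ->] := wnk.
  have [j zj] := ze w z wnk' zw.
  exists (inl (nk, j)) => /=; rewrite asboolT //; exists w => //.
  by rewrite zj.
- move=> [x|i] /=.
    case: asboolP => [sx|_]; last by apply: diam_le.
    apply: diam_le; first by rewrite mulr_ge0 // addr_ge0 // ltW.
    move=> _ _ [w /andP[w1 w2] <-] [w' /andP[w1' w2'] <-]; rewrite spherical_distE.
    by have [] := arc x w w' sx; rewrite ?w1 ?w1' ?(ltW w2) ?(ltW w2').
  by apply: diam_le => // _ _ -> ->; rewrite spherical_dist_refl.
- have delta0 : 0 <= delta by rewrite (le_trans _ eta_delta) // ltW.
  move=> [x|i] /=.
    case: asboolP => [sx|_]; last by apply: diam_le.
    apply: diam_le => //.
    move=> _ _ [w /andP[w1 w2] <-] [w' /andP[w1' w2'] <-]; rewrite spherical_distE.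
    have [] := arc x w w' sx; rewrite ?w1 ?w1' ?(ltW w2) ?(ltW w2') // => _ h.
    exact: le_trans h eta_delta.
  by apply: diam_le => // _ _ -> ->; rewrite spherical_dist_refl.
move=> s us.
pose pr (t : nat * int * 'I_d + nat) :=
  if t is inl x then if `[< sel x >] then Some x else None else None.
pose s' := pmap pr s.
have us' : uniq s'.
  apply: (@pmap_uniq _ _ pr inl) us => -[x|i] //=; by case: ifP.
have s'sel x : x \in s' -> sel x.
  rewrite mem_pmap => /mapP[[y|i] _] //=; case: ifP => // /asboolP sy [->] //.
have -> : \sum_(t <- s) len t = (1 + eps) * \sum_(x <- s') sdist (Z x (u x)) (Z x (v x)).
  rewrite mulr_sumr /s'; elim: (s) => [|[x|i] r IHr] /=; first by rewrite !big_nil.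
    by rewrite big_cons /= IHr; case: ifP => _ /=; rewrite ?big_cons ?add0r.
  by rewrite big_cons /= add0r.
apply: ler_wpM2l; first by rewrite addr_ge0 // ltW.
apply: (arcs_length_le pq sp sq (M := fun x => (1 + eps) * (Zm x.1).2 x.2) x0_nonreal) => //.
- by rewrite ltW.
- move=> x /s'sel sx; have [m0 zr _ _ H] := HZ x.1 sx.1; split.
  + exact: ltW.
  + by rewrite mulr_ge0 ?addr_ge0 // ltW.
  + by have [] := arc x (u x) (v x) sx; rewrite ?lexx ?(ltW (uv x)).
  + by move=> w; exact: zr.
  + by move=> a b ha hb; have [_ h _] := H x.2 a b ha hb; rewrite -mulrA.
- move=> x y w /s'sel sx /s'sel sy /andP[x1 x2] /andP[y1 y2] zz.
  have xy : x.1 = y.1.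
    by apply: (maximal_dyadic_disjoint (w := w) sx sy); rewrite ltW.
  case: x y xy sx sy x1 x2 y1 y2 zz => [nk j] [nk' j'] /= <- sx _ x1 x2 _ _ zz.
  have [_ _ zi _ _] := HZ nk sx.1.
  by congr pair; apply: (zi j j' w) => //; rewrite !ltW.
Qed.

Lemma real_preimage_length (E : set (sphere R)) :
  (forall z, E (Some z) -> real_ratio p q z) ->
  (spherical_length E <= (d%:R * (2 * pi))%:E)%E.
Proof.
move=> ER; apply: ge_ereal_sup => _ [delta /= delta0 <-].
apply/lee_addgt0Pr => e e0.
pose D : R := (d + d)%:R.
have D0 : 0 < D by rewrite ltr0n addn_gt0 d_gt0.
have pi0 := pi_ge2 R.
have K0 : 0 < D * (pi + 2) by rewrite mulr_gt0 //; lra.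
pose eps := Num.min 1 (e / (D * (pi + 2))).
have eps0 : 0 < eps by rewrite lt_min ltr01 divr_gt0.
have eps1 : eps <= 1 by rewrite ge_min lexx.
have epse : eps * (D * (pi + 2)) <= e by rewrite -ler_pdivlMr // ge_min lexx orbT.
pose eta := Num.min eps delta.
have eta0 : 0 < eta by rewrite lt_min eps0.
have etae : eta <= eps by rewrite ge_min lexx.
have etad : eta <= delta by rewrite ge_min lexx orbT.
have etapi : eta < pi by lra.
apply: le_trans (real_preimage_delta ER eps0 eta0 etapi etad) _.
rewrite -EFinD lee_fin.
have -> : d%:R * (2 * pi) = D * pi by rewrite /D natrD; ring.
rewrite mulrCA -/D; apply: (@le_trans _ _ (D * pi + eps * (D * (pi + 2)))); last first.
  by rewrite lerD2l.
have -> : D * pi + eps * (D * (pi + 2)) = D * (pi + eps * (pi + 2)) by ring.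
by rewrite ler_pM2l //; nra.
Qed.

End RealPreimage.

(** * Degenerate fibres and Moebius changes of the target *)

Section Reduction.
Local Open Scope complex_scope.
Context {R : realType}.
Local Notation C := R[i].
Implicit Types (z : C) (p q : {poly C}).

Lemma conjc_fix_real (x : C) : conjc x = x -> x \is Num.real.
Proof.
by case: x => a b [/eqP]; rewrite complex_real -subr_eq0 -opprD oppr_eq0 -mulr2n mulrn_eq0.
Qed.

(** If the Wronskian vanishes, then each of [p] and [q] divides its derivative and
is constant. *)
Lemma wronskian_neq0 p q : coprimep p q -> (1 < maxn (size p) (size q))%N ->
  wronskian p q != 0.
Proof.
move=> pq spq; rewrite /wronskian subr_eq0; apply/eqP => W0.
have const (g : {poly C}) : g %| g^`() -> (size g <= 1)%N.
  move=> gd; have [g0|g0] := eqVneq g 0; first by rewrite g0 size_poly0.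
  have [dg0|dg0] := eqVneq g^`() 0.
    rewrite leqNgt; apply/negP; case sg : (size g) => [|[|k]] // _.
    have /eqP := congr1 (fun h : {poly C} => h`_k) dg0.
    rewrite coef_deriv coef0 mulrn_eq0 /= -[k.+1]/(k.+2.-1) -sg -/(lead_coef g).
    by rewrite lead_coef_eq0 (negPf g0).
  by have := dvdp_leq dg0 gd; rewrite leqNgt lt_size_deriv.
have p1 : (size p <= 1)%N.
  by apply: const; rewrite -(Gauss_dvdpl _ pq) W0 dvdp_mulr.
have q1 : (size q <= 1)%N.
  by apply: const; rewrite coprimep_sym in pq; rewrite -(Gauss_dvdpr _ pq) -W0 dvdp_mull.
by move: spq; rewrite leq_max !ltnNge p1 q1.
Qed.

Lemma wronskian_combination p q (a b c e : C) :
  wronskian (a *: p + b *: q) (c *: p + e *: q) = (a * e - b * c) *: wronskian p q.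
Proof.
rewrite /wronskian !derivD !derivZ -!mul_polyC rmorphB !rmorphM /=.
by ring.
Qed.

Lemma coprimep_combination p q (a b c e : C) : coprimep p q -> a * e - b * c != 0 ->
  coprimep (a *: p + b *: q) (c *: p + e *: q).
Proof.
move=> pq det; apply/Pdiv.ClosedField.coprimepP => x.
rewrite /root !hornerD !hornerZ => /eqP r1; apply/eqP => r2.
have p0 : p.[x] = 0.
  apply/(mulfI det); rewrite mulr0.
  transitivity (e * (a * p.[x] + b * q.[x]) - b * (c * p.[x] + e * q.[x])); first by ring.
  by rewrite r1 r2; ring.
have q0 : q.[x] = 0.
  apply/(mulfI det); rewrite mulr0.
  transitivity (a * (c * p.[x] + e * q.[x]) - c * (a * p.[x] + b * q.[x])); first by ring.
  by rewrite r1 r2; ring.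
by have /Pdiv.ClosedField.coprimepP/(_ x) := pq; rewrite /root p0 q0 eqxx => /(_ isT).
Qed.

Lemma combination_neq0 p q (a b : C) : wronskian p q != 0 -> (a != 0) || (b != 0) ->
  a *: p - b *: q != 0.
Proof.
move=> W0 ab; apply/negP; rewrite subr_eq0 => /eqP E.
have E' : a *: p^`() = b *: q^`() by rewrite -!derivZ E.
have aW : a *: wronskian p q = 0.
  rewrite /wronskian scalerBr !scalerAl E E' -!scalerAl -scalerBr.
  by rewrite mulrC subrr scaler0.
have bW : b *: wronskian p q = 0.
  rewrite /wronskian scalerBr !scalerAr -E -E' -!scalerAr -scalerBr.
  by rewrite [_ * p]mulrC subrr scaler0.
move/eqP: aW; move/eqP: bW; rewrite !scaler_eq0 (negPf W0) !orbF => /eqP b0 /eqP a0.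
by rewrite a0 b0 eqxx in ab.
Qed.

(** One of the polynomials [p - 'i q] and [p + 'i q] has a root, at which [p / q]
is not real. *)
Lemma exists_nonreal p q : coprimep p q -> wronskian p q != 0 ->
  exists x, ~~ real_ratio p q x.
Proof.
move=> pq W0.
have [g [s [gE s2 sg]]] : exists (g : {poly C}) (s : C),
    [/\ g = p - s *: q, s ^+ 2 = -1 & size g != 1%N].
  have [s1|?] := eqVneq (size (p - 'i%C *: q)) 1%N; last first.
    by exists (p - 'i%C *: q), 'i%C; rewrite sqr_i.
  have [s1'|?] := eqVneq (size (p - (- 'i%C) *: q)) 1%N; last first.
    by exists (p - (- 'i%C) *: q), (- 'i%C); rewrite sqrrN sqr_i.
  have /eqP/size_poly1P[c1 _ e1] := s1; have /eqP/size_poly1P[c2 _ e2] := s1'.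
  have i0 : 'i%C != 0 :> C by rewrite -sqrf_eq0 sqr_i oppr_eq0 oner_eq0.
  have dp : p^`() = 'i%C *: q^`().
    by apply/eqP; rewrite -subr_eq0 -derivZ -derivB e1 derivC.
  have dp' : p^`() = - 'i%C *: q^`().
    by apply/eqP; rewrite -subr_eq0 -derivZ -derivB e2 derivC.
  have dq : q^`() = 0.
    have : (2 * 'i%C : C) *: q^`() = 0.
      by rewrite mulr2n mulrDl mul1r scalerDl -{1}dp dp' -scalerDl addNr scale0r.
    by move/eqP; rewrite scaler_eq0 mulf_eq0 pnatr_eq0 (negPf i0) => /eqP.
  by move: W0; rewrite /wronskian dp dq scaler0 mul0r mulr0 subrr eqxx.
have [x] := closed_rootP _ sg.
rewrite gE /root hornerD hornerN hornerZ subr_eq0 => /eqP px; exists x.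
have q0 : q.[x] != 0.
  apply/eqP => q0; have /Pdiv.ClosedField.coprimepP/(_ x) := pq.
  by rewrite /root px q0 mulr0 eqxx => /(_ isT).
apply/negP; rewrite /real_ratio px => /eqP e.
have qq : q.[x] * conjc q.[x] != 0 by rewrite mulf_neq0 // conjc_eq0.
have sc : conjc s = s.
  apply: (mulIf qq); transitivity (conjc (s * q.[x]) * q.[x]).
    by rewrite rmorphM /=; ring.
  by rewrite -e; ring.
case: s s2 sc {gE px e} => a b; simpc => -[e1 e2] [/eqP]; rewrite -subr_eq0 => /eqP h.
have b0 : b = 0 by lra.
by move: e1; rewrite b0; nra.
Qed.

(** The polynomial [g] vanishes at the poles and at the points over the finitely
many values at which the fibre contains infinity or a critical point. *)
Lemma finitely_many_bad p q d : coprimep p q -> wronskian p q != 0 ->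
  (p`_d != 0) || (q`_d != 0) ->
  exists bad : seq C, forall z, real_ratio p q z -> z \notin bad ->
    exists2 w, good_value p q d w & root (fiber p q w) z.
Proof.
move=> pq W0 pqd.
have common x : p.[x] = 0 -> q.[x] = 0 -> False.
  move=> p0 q0; have /Pdiv.ClosedField.coprimepP/(_ x) := pq.
  by rewrite /root p0 q0 eqxx => /(_ isT).
have [crit critE] := closed_field_poly_normal (wronskian p q).
pose g := q * (q`_d *: p - p`_d *: q) * \prod_(x <- crit) (q.[x] *: p - p.[x] *: q).
have g0 : g != 0.
  rewrite !mulf_neq0 //.
  - have /(_ 0 1) := @combination_neq0 p q _ _ W0.
    by rewrite oner_eq0 orbT scale0r scale1r sub0r oppr_eq0; apply.
  - by apply: combination_neq0 => //; rewrite orbC.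
  - rewrite prodf_seq_neq0; apply/allP => x _ /=.
    apply: combination_neq0 => //; rewrite -negb_and; apply/negP => /andP[/eqP qx /eqP px].
    exact: common px qx.
have [bad badE] := closed_field_poly_normal g.
have badP z : z \notin bad -> g.[z] != 0.
  by rewrite badE hornerZ mulf_eq0 lead_coef_eq0 (negPf g0) -root_prod_XsubC.
exists bad => z /eqP zr /badP; rewrite !hornerM !mulf_eq0 !negb_or => /andP[/andP[qz lz] cz].
pose w : R := complex.Re (p.[z] / q.[z]).
have wE : p.[z] = w%:C * q.[z].
  have rl : p.[z] / q.[z] \is Num.real.
    apply: conjc_fix_real; rewrite rmorphM fmorphV /=; apply/eqP.
    by rewrite eqr_div ?conjc_eq0 // zr mulrC.
  by rewrite /w RRe_real // divfK.
exists w; last by rewrite -fiberE wE.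
split.
  apply: contraNN lz; rewrite /fiber_top subr_eq0 => /eqP l.
  by rewrite hornerD hornerN !hornerZ l wE; apply/eqP; ring.
move=> x xw; have qx := fiber_q_neq0 pq xw; split => //.
apply/negP => Wx; have xc : x \in crit.
  move: Wx; rewrite {1}critE hornerZ mulf_eq0 lead_coef_eq0 (negPf W0) /=.
  by rewrite -/(root _ x) root_prod_XsubC.
move: cz; rewrite horner_prod prodf_seq_eq0; case/negP; apply/hasP; exists x => //=.
move: xw; rewrite -fiberE => /eqP px.
by rewrite hornerD hornerN !hornerZ wE px; apply/eqP; ring.
Qed.

End Reduction.

(** * Preimages of circles *)

Section Circles.
Local Open Scope complex_scope.
Context {R : realType}.
Local Notation C := R[i].
Implicit Types (p q : {poly C}) (z : C).

Lemma combination_preimage_length p q (a b c e : C) (E : set (sphere R)) :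
  coprimep p q -> (0 < ratdeg p q)%N -> a * e - b * c != 0 ->
  (forall z, E (Some z) -> real_ratio (a *: p + b *: q) (c *: p + e *: q) z) ->
  (spherical_length E <= ((ratdeg p q)%:R * (2 * pi))%:E)%E.
Proof.
move=> pq d0 det ER.
have max_gt1 : (1 < maxn (size p) (size q))%N.
  by move: d0; rewrite /ratdeg; case: maxn => [|[|]].
have W0 : wronskian (a *: p + b *: q) (c *: p + e *: q) != 0.
  by rewrite wronskian_combination scaler_eq0 negb_or det wronskian_neq0.
have pq1 := coprimep_combination pq det.
have [x x_nonreal] := exists_nonreal pq1 W0.
set d := ratdeg p q in d0 *.
have dE : d.+1 = maxn (size p) (size q) by rewrite /d /ratdeg prednK // ltnW.
have sizes (k l : C) : (size (k *: p + l *: q)%R <= d.+1)%N.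
  rewrite dE; apply: leq_trans (size_polyD _ _) _; rewrite geq_max.
  by rewrite !(leq_trans (size_scale_leq _ _)) ?leq_maxl ?leq_maxr.
have top_neq0 : (p`_d != 0) || (q`_d != 0).
  rewrite -negb_and; apply/negP => /andP[/eqP pd /eqP qd].
  have [qp|/ltnW pq_le] := leqP (size q) (size p).
    move: pd max_gt1; rewrite /d /ratdeg (maxn_idPl qp) -/(lead_coef p) => /eqP.
    by rewrite lead_coef_eq0 => /eqP ->; rewrite size_poly0.
  move: qd max_gt1; rewrite /d /ratdeg (maxn_idPr pq_le) -/(lead_coef q) => /eqP.
  by rewrite lead_coef_eq0 => /eqP ->; rewrite size_poly0.
have top1_neq0 : ((a *: p + b *: q)`_d != 0) || ((c *: p + e *: q)`_d != 0).
  rewrite -negb_and !coefD !coefZ; apply/negP => /andP[/eqP h1 /eqP h2].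
  suff /andP[p0 q0] : (p`_d == 0) && (q`_d == 0) by rewrite p0 q0 in top_neq0.
  have hp : (a * e - b * c) * p`_d =
      e * (a * p`_d + b * q`_d) - b * (c * p`_d + e * q`_d) by ring.
  have hq : (a * e - b * c) * q`_d =
      a * (c * p`_d + e * q`_d) - c * (a * p`_d + b * q`_d) by ring.
  move/eqP: hp; move/eqP: hq; rewrite h1 h2 !mulr0 subrr !mulf_eq0 (negPf det) /=.
  by move=> -> ->.
have [bad badP] := finitely_many_bad pq1 W0 top1_neq0.
exact: (real_preimage_length pq1 (sizes a b) (sizes c e) d0 x_nonreal badP ER).
Qed.

(** The Cayley transform maps the unit circle to the real line. *)
Lemma circle_real_ratio (P Q : C) (r : R) : `|P| = r%:C * `|Q| ->
  ('i%C * (r%:C * Q + P)) * conjc (r%:C * Q - P) =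
  conjc ('i%C * (r%:C * Q + P)) * (r%:C * Q - P).
Proof.
move=> h; have e : P * conjc P = r%:C ^+ 2 * (Q * conjc Q).
  by rewrite -!sqr_normc h exprMn.
move: e; case: P {h} => x y; case: Q => u v; rewrite /real_complex_def; simpc.
by move=> [e _]; congr (_ +i* _); lra.
Qed.

End Circles.

Theorem theorem2 (R : realType) (d : nat) (f : sphere R -> sphere R)
    (C : set (sphere R)) (d_ge1 : (1 <= d)%N) (f_rat : is_rational d f)
    (C_circle : is_circle C) :
  (spherical_length (f @^-1` C) <= (d%:R * (2 * pi))%:E)%E.
Proof.
have [p [q [pq q0 dE fE]]] := f_rat; rewrite {}dE in d_ge1 *; rewrite {}fE.
have ratmapE z : ratmap p q (Some z) =
  if q.[z] == 0 then None else Some (p.[z] / q.[z]) by [].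
case: C_circle => [[c [r [r0 ->]]]|[a [v [v0 ->]]]].
  pose I : R[i] := 'i%C; pose rC : R[i] := (r%:C)%C.
  apply: (combination_preimage_length (a := I) (b := I * (rC - c))
    (c := -1) (e := rC + c) pq d_ge1).
    have -> : I * (rC + c) - I * (rC - c) * -1 = 2 * rC * I by ring.
    rewrite !mulf_neq0 ?pnatr_eq0 //.
    - by rewrite (inj_eq (@complexI R)) gt_eqF.
    - by rewrite -sqrf_eq0 sqr_i oppr_eq0 oner_eq0.
  move=> z; rewrite /preimage /= ratmapE => -[w wr].
  have [//|qz [wE]] := eqVneq q.[z] 0.
  rewrite /real_ratio !hornerD !hornerZ.
  have -> : I * p.[z] + I * (rC - c) * q.[z] = I * (rC * q.[z] + (p.[z] - c * q.[z])) by ring.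
  have -> : -1 * p.[z] + (rC + c) * q.[z] = rC * q.[z] - (p.[z] - c * q.[z]) by ring.
  apply/eqP/circle_real_ratio; rewrite -wr wE -normrM; congr `|_|.
  by rewrite mulrBl divfK.
apply: (combination_preimage_length (a := 1) (b := - a) (c := 0) (e := v) pq d_ge1).
  by rewrite mul1r mulr0 subr0.
move=> z; rewrite /preimage /= ratmapE /real_ratio !hornerD !hornerZ !mul1r mul0r add0r.
have [-> _|qz] := eqVneq q.[z] 0.
  by rewrite !mulr0 rmorph0 !mulr0.
case=> [//|[t _ [wE]]].
have -> : p.[z] + - a * q.[z] = (t%:C)%C * (v * q.[z]).
  by rewrite -[p.[z]](divfK qz) -wE; ring.
by rewrite conjc_realM; apply/eqP; ring.
Qed.
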